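(* Let $T$ be a rising tree with discriminator $D$ and slope interval $I_T$. Let $\ell$ be an index line of slope $s$, with $s$ possibly infinite. If $s\notin I_T$ then the tree numbers are monotone along $\ell$. If $s\in I_T$ then the tree numbers along $\ell$ are antimodal if $D<4$, constant if $D=4$, and modal if $D>4$. For each $s\in I_T\cap(\mathbb Q\cup\{\pm\infty\})$ there exist index lines of slope $s$ along which the tree numbers are not monotone.
   Context: All fractions $k/n$ are in lowest terms with $n\ge1$. Two fractions $a/b<c/d$ in $[0,1]$ are Farey neighbours if $bc-ad=1$; their mediant is $(a+c)/(b+d)$. Each $q\in\mathbb Q\cap(0,1)$ is the mediant of a unique pair of Farey neighbours in $[0,1]$, denoted $q_0<q_0'$. A real Markov tree $T$ with base triple $(s_0,u_0,t_0)\in\mathbb R^3$ is a rooted planar trivalent tree (the root has degree 1, all other vertices degree 3) whose complementary regions carry real labels; the root edge has the region $s_0$ on its left, $t_0$ on its right, and leads to the region $u_0$; and for every non-root edge, with regions $s,t$ on its two sides and $r,u$ at its two ends, $r+u=st$. The regions are Farey-indexed by $\mathbb Q\cap[0,1]$, writing $m_q=m(T)_q$: $m_0=s_0$, $m_{1/2}=u_0$, $m_1=t_0$, and for each $q\in\mathbb Q\cap(0,1)$, if $p$ is the mediant of $q_0,q$ and $p'$ the mediant of $q,q_0'$, then $m_p=m_{q_0}m_q-m_{q_0'}$ and $m_{p'}=m_qm_{q_0'}-m_{q_0}$. The non-root vertices correspond to $q\in\mathbb Q\cap(0,1)$: the regions $q_0,q,q_0'$ meet at vertex $q$. Let $e_q$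 be the edge at vertex $q$ on the side of the root. It is (positively) directed away from the root if $2m_q-m_{q_0}m_{q_0'}>0$, towards the root if this is negative, and undirected if it is $0$. The discriminator is $D=s_0^2+u_0^2+t_0^2-s_0u_0t_0$. $T$ is a rising tree if all labels are $>2$ and all edges are positively directed away from the root except for those on a finite (possibly empty) simple path starting at the root. The encoding function $\Phi_T:[0,1]\to\mathbb R_{\ge0}$ is the unique continuous function with $m_{k/n}=2\cosh(n\Phi_T(k/n))$ for all $k/n\in\mathbb Q\cap[0,1]$ (it exists for rising trees). The lattice curve is $\Gamma_T=\{(1/y,x/y): x\in[0,1],\ y=\Phi_T(x)\}$. The slope interval $I_T\subset\mathbb R\cup\{\pm\infty\}$ is the set of all slopes of lines through pairs of distinct points of $\Gamma_T$ (vertical lines having slope $\pm\infty$). An index line is a line $\ell$ in the plane passing through some lattice points $(n,k)\in\mathbb Z^2$ with $0\le k\le n$ and $\gcd(n,k)=1$. List all such points on $\ell$ in order along the line as $(n_i,k_i)$; the tree numbers along $\ell$ are the sequence $m(T)_{k_i/n_i}$. A sequence is monotone if it is strictly increasing or strictly decreasing; empty and singleton sequences are trivially monotone. A sequence is modal if it has the form $m_1<m_2<\cdots<m_r\le m_{r+1}>\cdots>m_{t-1}>m_t$, and antimodal if it has this form with all inequalities reversed; these notions extend in the obvious way to infinite sequences, and monotone sequences are trivially both modal and antimodal. *)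

(* Defs.v *)
From HB Require Import structures.
From mathcomp Require Import all_boot all_order all_algebra.
From mathcomp Require Import all_classical all_reals all_analysis.
Set Implicit Arguments.
Unset Strict Implicit.
Unset Printing Implicit Defensive.
Import Order.TTheory GRing.Theory Num.Theory.
Import numFieldNormedType.Exports.
Local Open Scope classical_set_scope.
Local Open Scope ring_scope.

(** * Farey indexing (a rational is read in lowest terms, [numq q / denq q]) *)

Definition farey_neighbours (x y : rat) : bool :=
  [&& 0 <= x, x < y, y <= 1 & denq x * numq y - numq x * denq y == 1].

Definition mediant (x y : rat) : rat :=
  (numq x + numq y)%:Q / (denq x + denq y)%:Q.

(* [x < y] is the pair written q_0 < q_0' *)
Definition farey_parents (q x y : rat) : Prop :=
  farey_neighbours x y /\ q = mediant x y.

Definition farey_child (q p : rat) : Prop :=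
  exists x y : rat,
    farey_parents q x y /\ (p = mediant x q \/ p = mediant q y).

(** * Real Markov trees *)

(* [m q] is the label of the region indexed by [q]; the values of [m] outside
   [0, 1] are irrelevant. *)
Definition markov_tree (R : realType) (s0 u0 t0 : R) (m : rat -> R) : Prop :=
  [/\ m 0 = s0, m (1 / 2) = u0, m 1 = t0 &
      forall q x y : rat, farey_parents q x y ->
        m (mediant x q) = m x * m q - m y /\
        m (mediant q y) = m q * m y - m x].

Definition discriminator (R : realType) (s0 u0 t0 : R) : R :=
  s0 ^+ 2 + u0 ^+ 2 + t0 ^+ 2 - s0 * u0 * t0.

(* The edges of the tree are the e_q, for q in (0, 1). *)
Definition edge_away (R : realType) (m : rat -> R) (q : rat) : Prop :=
  forall x y : rat, farey_parents q x y -> 0 < 2 * m q - m x * m y.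

(* The exceptional simple path from the root consists of the [N] edges
   e_(v 0), ..., e_(v (N - 1)); it starts with the root edge e_(1/2), and in a
   tree a simple path from the root always goes from a vertex to a child. *)
Definition rising (R : realType) (m : rat -> R) : Prop :=
  (forall q : rat, 0 <= q <= 1 -> 2 < m q) /\
  exists (N : nat) (v : nat -> rat),
    [/\ v 0%N = 1 / 2,
        forall i : nat, (i.+1 < N)%N -> farey_child (v i) (v i.+1) &
        forall q : rat, 0 < q < 1 ->
          (forall i : nat, (i < N)%N -> q <> v i) -> edge_away m q].

(** * Encoding function, lattice curve, slope interval *)

Definition cosh (R : realType) (x : R) : R := (expR x + expR (- x)) / 2.

(* These conditions determine [Phi] on [0, 1]. *)
Definition encoding_function (R : realType) (m : rat -> R) (Phi : R -> R) :
    Prop :=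
  [/\ {within `[0, 1], continuous Phi},
      forall x : R, 0 <= x <= 1 -> 0 <= Phi x &
      forall q : rat, 0 <= q <= 1 ->
        m q = 2 * cosh ((denq q)%:~R * Phi (ratr q))].

Definition lattice_curve (R : realType) (Phi : R -> R) : set (R * R) :=
  [set P | exists2 x : R, 0 <= x <= 1 & P = (1 / Phi x, x / Phi x)].

(* [s] is a slope of the line through two distinct points [P] and [Q]; a
   vertical line is given both slopes [+oo] and [-oo]. *)
Definition chord_slope (R : realType) (P Q : R * R) (s : \bar R) : Prop :=
  (P.1 = Q.1 /\ (s = +oo \/ s = -oo)%E) \/
  (P.1 <> Q.1 /\ s = ((Q.2 - P.2) / (Q.1 - P.1))%:E).

Definition slope_interval (R : realType) (Phi : R -> R) : set (\bar R) :=
  [set s | exists P Q : R * R,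
     [/\ lattice_curve Phi P, lattice_curve Phi Q, P <> Q & chord_slope P Q s]].

Definition infinite_or_rational (R : realType) (s : \bar R) : Prop :=
  (s = +oo \/ s = -oo)%E \/ exists q : rat, s = (ratr q)%:E.

(** * Lines and index lines *)

Definition is_line (R : realType) (l : set (R * R)) : Prop :=
  exists a b c : R, (a != 0) || (b != 0) /\
    l = [set P | a * P.1 + b * P.2 = c].

Definition line_slope (R : realType) (l : set (R * R)) (s : \bar R) : Prop :=
  exists P Q : R * R, [/\ l P, l Q, P <> Q & chord_slope P Q s].

(* The points (n, k) carry the lexicographic order, which on the points of a
   given line is the order along that line (by [n], or by [k] if the line is
   vertical).  The opposite orientation of the line would give the same notions
   of monotone, modal and antimodal below. *)
Definition index_points (R : realType) (l : set (R * R)) :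
    set (int *l int) :=
  [set P : int *l int |
     [/\ 0 <= P.2 <= P.1, coprimez P.1 P.2 & l (P.1%:~R, P.2%:~R)]].

Definition index_line (R : realType) (l : set (R * R)) : Prop :=
  is_line l /\ index_points l !=set0.

Definition tree_number (R : realType) (m : rat -> R) (P : int *l int) : R :=
  m (P.2%:Q / P.1%:Q).

(** * Sequences
    A finite or infinite sequence is a function [f] on a set [S] of indices in
    a totally ordered type. *)

Definition increasing_on d (T : orderType d) (R : realType)
    (S : set T) (f : T -> R) : Prop :=
  forall i j : T, S i -> S j -> (i < j)%O -> f i < f j.

Definition decreasing_on d (T : orderType d) (R : realType)
    (S : set T) (f : T -> R) : Prop :=
  forall i j : T, S i -> S j -> (i < j)%O -> f j < f i.

Definition monotone_on d (T : orderType d) (R : realType)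
    (S : set T) (f : T -> R) : Prop :=
  increasing_on S f \/ decreasing_on S f.

Definition consecutive_in d (T : orderType d) (S : set T) (i j : T) : Prop :=
  [/\ S i, S j, (i < j)%O & ~ exists2 k : T, S k & (i < k < j)%O].

(* ... < f r <= f r' > ... , where r' is the index following r *)
Definition modal_on d (T : orderType d) (R : realType)
    (S : set T) (f : T -> R) : Prop :=
  monotone_on S f \/
  exists r r' : T,
    [/\ consecutive_in S r r',
        increasing_on (S `&` [set i | (i <= r)%O]) f,
        f r <= f r' &
        decreasing_on (S `&` [set i | (r' <= i)%O]) f].

Definition antimodal_on d (T : orderType d) (R : realType)
    (S : set T) (f : T -> R) : Prop :=
  modal_on S (fun i => - f i).

Definition constant_on d (T : orderType d) (R : realType)
    (S : set T) (f : T -> R) : Prop :=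
  forall i j : T, S i -> S j -> f i = f j.

(* Main.v *)
Require Import Defs.
From HB Require Import structures.
From mathcomp Require Import all_boot all_order all_algebra.
From mathcomp Require Import all_classical all_reals all_analysis.
From mathcomp Require Import zify ring lra.
Set Implicit Arguments.
Unset Strict Implicit.
Unset Printing Implicit Defensive.
Import Order.TTheory GRing.Theory Num.Theory.
Import numFieldNormedType.Exports.
Local Open Scope classical_set_scope.
Local Open Scope ring_scope.

(* Write F(n, k) = n Phi(k/n), so that labels are 2 cosh F.  At a vertex with
   regions 2 cosh a, 2 cosh b, z, the invariance of the discriminator reads
   D - 4 = (z - 2 cosh (a + b)) (z - 2 cosh (a - b)).  Hence on edges directed
   away from the root F is sub-, super- or exactly additive over Farey sums
   according to the sign of D - 4, and a deep enough Farey interval has Phi on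
   the corresponding side of its chord.  At a rational point Phi has a corner,
   computed from the linear recursion of the labels around a region, which is
   convex for D < 4 and concave for D > 4.  Together these forbid Phi to touch a
   line from the wrong side, so Phi is strictly convex (D < 4), affine (D = 4) or
   strictly concave (D > 4), and along an index line the labels are cosh of a
   strictly convex, linear or strictly concave function.  Two points of equal F
   on a line rescale to a chord of the lattice curve F = 1 of the same slope,
   which ties the slope interval to the failure of monotonicity. *)

(** Finitely many edges near the root may spoil the additivity of F, so convexity is obtained
    locally: no point of the graph touches a line from the wrong side, and maximising the difference
    between [Phi] and a chord makes this global. Farey intervals alone do not give the local
    statement at a rational point: beyond its denominator such a point is only ever an endpoint of
    Farey intervals, so no chord passes over it. The corner fills this gap and also supplies
    strictness, the Farey inequalities being used in weak form only. For the existence of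
    non-monotone index lines, a chord of the lattice curve is a segment with equal F at both ends,
    but it need not contain integer points. When its slope is rational or infinite it is rescaled to
    a parallel lattice line at a large prime level, where primitive points are dense enough to meet
    any prescribed subintervals. *)

(** * Farey pairs *)

(* [farey n k n' k'] : k/n < k'/n' are Farey neighbours in [0, 1]. *)
Inductive farey : nat -> nat -> nat -> nat -> Prop :=
| farey_root : farey 1 0 1 1
| farey_left n k n' k' : farey n k n' k' -> farey n k (n + n') (k + k')
| farey_right n k n' k' : farey n k n' k' -> farey (n + n') (k + k') n' k'.

Lemma fareyP n k n' k' : farey n k n' k' ->
  [/\ (0 < n)%N, (0 < n')%N, (k <= n)%N, (k' <= n')%N & (n * k' = k * n' + 1)%N].
Proof.
elim=> {n k n' k'} [|n k n' k' _ [? ? ? ? ?]|n k n' k' _ [? ? ? ? ?]] //;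
  split; nia.
Qed.

Lemma farey_lt n k n' k' : farey n k n' k' -> (0 < k')%N /\ (k < n)%N.
Proof. by elim=> {n k n' k'} // n k n' k' /fareyP[? ? ? ? ?] [? ?]; split; lia. Qed.

(** Farey neighbours are [1 / (n * n')] apart, so this turns a large sum of denominators into a
    short interval. *)
Lemma addn_le_muln a b : (0 < a)%N -> (0 < b)%N -> (a + b <= a * b + 1)%N.
Proof. by nia. Qed.

Lemma bezout_coprime a b c d : (a * d = b * c + 1)%N -> coprime a b.
Proof.
move=> abcd; rewrite /coprime -dvdn1.
have : (gcdn a b %| b * c + 1)%N by rewrite -abcd dvdn_mulr ?dvdn_gcdl.
by rewrite dvdn_addr // dvdn_mulr ?dvdn_gcdr.
Qed.

Lemma farey_coprime n k n' k' : farey n k n' k' ->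
  [/\ coprime n k, coprime n' k' & coprime (n + n') (k + k')].
Proof.
move=> /fareyP[n0 n'0 kn k'n' det]; split; first exact: bezout_coprime det.
  by rewrite coprime_sym; apply: (@bezout_coprime _ _ k n); lia.
by apply: (@bezout_coprime _ _ n' k'); nia.
Qed.

(** The two sequences run through the neighbours of the region [(n + n', k + k')] and converge to
    its fraction, one from each side. *)
Lemma farey_iter n k n' k' j : farey n k n' k' ->
  farey (n + j * (n + n')) (k + j * (k + k')) (n + n') (k + k') /\
  farey (n + n') (k + k') (n' + j * (n + n')) (k' + j * (k + k')).
Proof.
move=> F; elim: j => [|j [IH1 IH2]].
  by rewrite !mul0n !addn0; split; [exact: farey_left|exact: farey_right].
split; first by have := farey_right IH1; rewrite -!addnA -!mulSnr.
by have := farey_left IH2; rewrite !(addnC (n + n')%N) !(addnC (k + k')%N) -!addnA -!mulSnr.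
Qed.

Definition frac (n k : nat) : rat := k%:R / n%:R.

Lemma numq_frac n k : (0 < n)%N -> coprime n k -> numq (frac n k) = k%:Z.
Proof.
move=> n0 cnk; rewrite /frac !pmulrn coprimeq_num ?absz_nat 1?coprime_sym //.
by rewrite gtr0_sg ?mul1r// ltz_nat.
Qed.

Lemma denq_frac n k : (0 < n)%N -> coprime n k -> denq (frac n k) = n%:Z.
Proof.
move=> n0 cnk; rewrite /frac !pmulrn coprimeq_den ?absz_nat 1?coprime_sym //.
by case: eqP => // -[n_0]; rewrite n_0 in n0.
Qed.

Lemma fracP (q : rat) : 0 <= q <= 1 ->
  exists n k, [/\ (0 < n)%N, (k <= n)%N, coprime n k & q = frac n k].
Proof.
move=> /andP[q0 q1]; exists `|denq q|%N, `|numq q|%N.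
have n0 : 0 <= numq q by rewrite numq_ge0.
have d0 := denq_gt0 q.
have qE : q = frac `|denq q| `|numq q|.
  rewrite /frac -[LHS]divq_num_den.
  by rewrite -[X in X%:Q / _](gez0_abs n0) -[X in _ / X%:Q](gtz0_abs d0).
split => //; first by rewrite absz_gt0 gt_eqF.
- have : numq q <= denq q by rewrite -(ler_int rat) numqE ler_piMl // ler0z ltW.
  by move: n0 d0; lia.
- by rewrite coprime_sym coprime_num_den.
Qed.

Lemma frac_itv n k : (0 < n)%N -> (k <= n)%N -> 0 <= frac n k <= 1.
Proof.
move=> n0 kn; rewrite /frac divr_ge0 ?ler0n//=.
by rewrite ler_pdivrMr ?ltr0n// mul1r ler_nat.
Qed.

Lemma ratr_frac (R : realType) n k : ratr (frac n k) = k%:R / n%:R :> R.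
Proof. by rewrite /frac fmorph_div /= !ratr_nat. Qed.

Lemma farey_parents_frac n k n' k' : farey n k n' k' ->
  farey_parents (frac (n + n') (k + k')) (frac n k) (frac n' k').
Proof.
move=> Fnk; have [n0 n'0 kn k'n' det] := fareyP Fnk.
have [c1 c2 c3] := farey_coprime Fnk.
have /andP[x0 _] := frac_itv n0 kn; have /andP[_ y1] := frac_itv n'0 k'n'.
split; last first.
  by rewrite /mediant !numq_frac // !denq_frac // /frac -!PoszD.
apply/and4P; split=> //.
  by rewrite /frac ltr_pdivrMr ?ltr0n// mulrAC ltr_pdivlMr ?ltr0n//
             -!natrM ltr_nat; lia.
by rewrite !numq_frac // !denq_frac //; apply/eqP; lia.
Qed.

Lemma mediant_frac n k n' k' : farey n k n' k' ->
  mediant (frac n k) (frac n' k') = frac (n + n') (k + k').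
Proof. by move=> /farey_parents_frac []. Qed.

Section Descent.
Variable R : realType.

(* Descending the Stern-Brocot tree towards [z]. *)
Lemma farey_descent (z : R) (K : nat) : 0 < z < 1 ->
  (exists n k n' k', [/\ farey n k n' k', (K <= n + n')%N,
     k%:R < n%:R * z & n'%:R * z < k'%:R]) \/
  (exists n k n' k', farey n k n' k' /\ (n + n')%:R * z = (k + k')%:R).
Proof.
move=> /andP[z0 z1]; elim: K => [|K [[n [k [n' [k' [F nK kz zk]]]]]|]]; last by right.
  left; exists 1%N, 0%N, 1%N, 1%N; split=> //; first exact: farey_root.
    by rewrite mul1r.
  by rewrite mul1r.
have [n0 n'0 _ _ _] := fareyP F.
have [lt|gt|eq] := ltrgtP ((n + n')%:R * z) (k + k')%:R.
- by left; exists n, k, (n + n')%N, (k + k')%N; split=> //; [exact: farey_left|lia].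
- by left; exists (n + n')%N, (k + k')%N, n', k'; split=> //; [exact: farey_right|lia].
- by right; exists n, k, n', k'.
Qed.

(** With determinant 1, [p = n * (k' * p - n' * j) + n' * (n * j - k * p)], and both factors in
    parentheses are positive. *)
Lemma farey_gap n k n' k' p j : farey n k n' k' ->
  (k * p < n * j)%N -> (n' * j < k' * p)%N -> (n + n' <= p)%N.
Proof. by move=> /fareyP[? ? ? ? det] h1 h2; nia. Qed.

Lemma rat_mediant p j : (0 < j < p)%N -> coprime p j ->
  exists n k n' k', [/\ farey n k n' k', p = (n + n')%N & j = (k + k')%N].
Proof.
move=> /andP[j0 jp] cpj; have p0 : (0 < p)%N by lia.
have pR : (0 : R) < p%:R by rewrite ltr0n.
have z01 : 0 < (j%:R / p%:R : R) < 1.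
  by rewrite divr_gt0 ?ltr0n//= ltr_pdivrMr// mul1r ltr_nat.
(* The first alternative would put [j / p] strictly inside a Farey interval whose mediant has
   denominator above [p], against [farey_gap]. *)
have [[n [k [n' [k' [F nK kz zk]]]]]|[n [k [n' [k' [F eq]]]]]] :=
    farey_descent p.+1 z01.
  move: kz zk; rewrite !mulrA ltr_pdivlMr// ltr_pdivrMr// -!natrM !ltr_nat => kz zk.
  by have := farey_gap F kz zk; lia.
exists n, k, n', k'; have [_ _ c] := farey_coprime F; have [n0 n'0 _ _ _] := fareyP F.
have eqN : ((n + n') * j = (k + k') * p)%N.
  apply/eqP; rewrite -(eqr_nat R) !natrM -eq; apply/eqP; field.
  by rewrite gt_eqF.
have d1 : (n + n' %| p)%N.
  by rewrite -(@Gauss_dvdr _ (k + k')) // -eqN dvdn_mulr.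
have d2 : (p %| n + n')%N by rewrite -(@Gauss_dvdl _ _ j) // eqN dvdn_mull.
have pE : p = (n + n')%N by apply/eqP; rewrite eqn_dvd d2 d1.
split=> //; apply/eqP; rewrite -(@eqn_pmul2l p) //.
by rewrite {1}pE eqN mulnC.
Qed.
End Descent.

(** * Labels and directed edges on Farey pairs *)

Section Tree.
Variables (R : realType) (s0 u0 t0 : R) (m : rat -> R).
Hypothesis hT : markov_tree s0 u0 t0 m.
Hypothesis hrising : rising m.

Definition label (n k : nat) : R := m (frac n k).

Lemma label_rec n k n' k' : farey n k n' k' ->
  label (n + (n + n')) (k + (k + k')) =
    label n k * label (n + n') (k + k') - label n' k' /\
  label (n + n' + n') (k + k' + k') =
    label (n + n') (k + k') * label n' k' - label n k.
Proof.
move=> F; have [_ _ _ /(_ _ _ _ (farey_parents_frac F))[<- <-]] := hT.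
by rewrite (mediant_frac (farey_left F)) (mediant_frac (farey_right F)).
Qed.

(** The recursion exchanges the two roots of the quadratic equation which the invariant imposes on
    one label when the other two are fixed. *)
Lemma label_discriminator n k n' k' : farey n k n' k' ->
  label n k ^+ 2 + label n' k' ^+ 2 + label (n + n') (k + k') ^+ 2
    - label n k * label n' k' * label (n + n') (k + k')
  = discriminator s0 u0 t0.
Proof.
elim=> {n k n' k'} [|n k n' k' F IH|n k n' k' F IH].
- have [m0 m2 m1 _] := hT; rewrite /discriminator -m0 -m1 -m2 /label /frac.
  by rewrite /= mul0r divr1; ring.
- by have [-> _] := label_rec F; rewrite -IH; ring.
- by have [_ ->] := label_rec F; rewrite -IH; ring.
Qed.

Lemma label_gt2 n k : (0 < n)%N -> (k <= n)%N -> 2 < label n k.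
Proof. by move=> n0 kn; have [+ _] := hrising; apply; exact: frac_itv. Qed.

Lemma rising_edges : exists K : nat, forall n k n' k', farey n k n' k' ->
  (K <= n + n')%N -> label n k * label n' k' < 2 * label (n + n') (k + k').
Proof.
have [_ [N [v [_ _ away]]]] := hrising.
(* The sum exceeds every denominator on the exceptional path, so a vertex of denominator at least
   this lies off that path. *)
exists (\sum_(i < N) `|denq (v i)|).+1%N => n k n' k' F Kn.
rewrite -subr_gt0; have [n0 n'0 kn k'n' det] := fareyP F.
have [_ _ c] := farey_coprime F; have [k'0 kn'] := farey_lt F.
apply: (away (frac (n + n') (k + k'))); last exact: farey_parents_frac.
  rewrite /frac divr_gt0 ?ltr0n ?ltr_pdivrMr ?ltr0n ?addn_gt0 ?n0 ?k'0 ?orbT//=.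
  by rewrite mul1r ltr_nat; lia.
move=> i iN /(congr1 denq); rewrite denq_frac ?addn_gt0 ?n0// => nE.
move: Kn; rewrite (bigD1 (Ordinal iN))//= -nE absz_nat; lia.
Qed.

End Tree.

(** * Hyperbolic cosines *)

Section RealLemmas.
Variable R : realType.
Implicit Types x y a b : R.
Local Notation cosh := (@Defs.cosh R).

Lemma coshE2 x : 2 * cosh x = expR x + expR (- x).
Proof. by rewrite /Defs.cosh mulrC divfK. Qed.

Lemma ltr_cosh x y : 0 <= x -> x < y -> cosh x < cosh y.
Proof.
move=> x0 xy; rewrite /Defs.cosh ltr_pM2r ?invr_gt0// !expRN.
have p1 : 1 <= expR x by rewrite -expR0 ler_expR.
have pq : expR x < expR y by rewrite ltr_expR.
have p0 := expR_gt0 x; have q0 := expR_gt0 y.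
rewrite -subr_gt0.
have -> : expR y + (expR y)^-1 - (expR x + (expR x)^-1) =
          (expR y - expR x) * (1 - (expR x * expR y)^-1).
  by field; rewrite !gt_eqF.
rewrite mulr_gt0 ?subr_gt0// invf_lt1 ?mulr_gt0//.
by nra.
Qed.

Lemma ler_cosh x y : 0 <= x -> x <= y -> cosh x <= cosh y.
Proof.
move=> x0; rewrite le_eqVlt => /predU1P[->//|xy]; exact/ltW/ltr_cosh.
Qed.

Lemma ltr_cosh_inv x y : 0 <= y -> cosh x < cosh y -> x < y.
Proof. by move=> y0 cxy; rewrite ltNge; apply/negP => /(ler_cosh y0); rewrite leNgt cxy. Qed.

Lemma cosh_le_expR x : 0 <= x -> cosh x <= expR x.
Proof.
move=> x0; rewrite -(ler_pM2l (ltr0n _ 2)) coshE2 mulr_natl mulr2n lerD2l ler_expR.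
by lra.
Qed.

Lemma cosh_gt0 x : 0 < cosh x.
Proof. by rewrite /Defs.cosh divr_gt0// addr_gt0// expR_gt0. Qed.

Lemma coshM a b : 2 * (cosh a * cosh b) = cosh (a + b) + cosh (a - b).
Proof.
rewrite /Defs.cosh !opprD opprK !expRD !expRN.
by field; rewrite !gt_eqF ?expR_gt0.
Qed.

Lemma cosh_quadratic a b z :
  (2 * cosh a) ^+ 2 + (2 * cosh b) ^+ 2 + z ^+ 2 - 2 * cosh a * (2 * cosh b) * z - 4 =
  (z - 2 * cosh (a + b)) * (z - 2 * cosh (a - b)).
Proof.
rewrite /Defs.cosh !opprD opprK !expRD !expRN.
by field; rewrite !gt_eqF ?expR_gt0.
Qed.

Lemma cosh_sub_le a b : 0 <= a -> 0 <= b -> cosh (a - b) <= cosh (a + b).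
Proof.
move=> a0 b0.
have -> : cosh (a - b) = cosh `|a - b|.
  by case: (ler0P (a - b)) => _ //; rewrite /Defs.cosh opprK addrC.
by apply: ler_cosh => //; rewrite ler_norml; lra.
Qed.

Lemma cosh_le_mono x y : 0 <= x -> 0 <= y -> (cosh x <= cosh y) = (x <= y).
Proof.
move=> x0 y0; apply/idP/idP; last exact: ler_cosh.
by rewrite !leNgt; apply: contra; exact: ltr_cosh.
Qed.

Lemma cosh_root (a b c : R) : 0 <= a -> 0 <= b ->
  2 * cosh c = 2 * cosh (a + b) \/ 2 * cosh c = 2 * cosh (a - b) ->
  exists b', `|b'| = b /\ cosh c = cosh (a + b').
Proof.
move=> a0 b0 [|] /(mulfI _) -> //; rewrite ?pnatr_eq0//.
  by exists b; rewrite ger0_norm.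
by exists (- b); rewrite normrN ger0_norm.
Qed.

(* The roots of the trace recursion are [E] and [E^-1]. *)
Lemma trace_recursion (E x0 y0 : R) (X : nat -> R) : 1 < E ->
  X 0%N = x0 -> X 1%N = (E + E^-1) * x0 - y0 ->
  (forall j, X j.+2 = (E + E^-1) * X j.+1 - X j) ->
  forall j, X j = (x0 * E - y0) / (E - E^-1) * E ^+ j +
                  (y0 - x0 / E) / (E - E^-1) * E ^- j.
Proof.
move=> E1 X0 X1 XS; have E0 : 0 < E by lra.
have nz : (E != 0) && (E * E - 1 != 0).
  by rewrite !gt_eqF// subr_gt0 -expr2 exprn_egt1.
move=> j; suff [] : X j = (x0 * E - y0) / (E - E^-1) * E ^+ j +
                  (y0 - x0 / E) / (E - E^-1) * E ^- j /\
   X j.+1 = (x0 * E - y0) / (E - E^-1) * E ^+ j.+1 +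
                  (y0 - x0 / E) / (E - E^-1) * E ^- j.+1 by [].
elim: j => [|j [IH1 IH2]].
  rewrite X0 X1 expr0 invr1 expr1; split; field; exact: nz.
split=> //; rewrite XS IH1 IH2 !exprS; field.
by rewrite nz gt_eqF ?exprn_gt0.
Qed.

(** By Bernoulli's inequality [E ^+ j] outgrows every constant, while the right-hand side stays
    below [|C|]. *)
Lemma exp_unbounded (E p C : R) (j0 : nat) : 1 < E ->
  (forall j, (j0 <= j)%N -> p * E ^+ j <= C * E ^- j) -> p <= 0.
Proof.
move=> E1 H; rewrite leNgt; apply/negP => p0.
have E0 : 0 < E by lra.
have bernoulli j : 1 + (E - 1) * j%:R <= E ^+ j.
  elim: j => [|j IH]; first by rewrite mulr0 addr0 expr0.
  have j0R : 0 <= (E - 1) ^+ 2 * j%:R by rewrite mulr_ge0 ?exprn_ge0// subr_ge0 ltW.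
  have : E * (1 + (E - 1) * j%:R) <= E * E ^+ j by rewrite ler_pM2l.
  by rewrite exprS -natr1; apply: le_trans; move: j0R; rewrite expr2; lra.
pose N := Num.bound (`|C| / (p * (E - 1))).
have Nb : `|C| / (p * (E - 1)) < N%:R by rewrite archi_boundP// divr_ge0// mulr_ge0; lra.
have pE : 0 < p * (E - 1) by rewrite mulr_gt0//; lra.
move: Nb; rewrite ltr_pdivrMr// => Nb.
have := H (j0 + N)%N (leq_addr _ _); apply/negP; rewrite -ltNge.
have EN1 : E ^- (j0 + N) <= 1 by rewrite invf_le1 ?exprn_gt0// exprn_ege1// ltW.
have EN0 : 0 < E ^- (j0 + N) by rewrite invr_gt0 exprn_gt0.
apply: (@le_lt_trans _ _ `|C|).
  apply: (@le_trans _ _ (`|C| * E ^- (j0 + N))); first by rewrite ler_pM2r// ler_norm.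
  by rewrite ler_piMr.
apply: (lt_le_trans Nb).
apply: (@le_trans _ _ (p * (1 + (E - 1) * (j0 + N)%:R))); last by rewrite ler_pM2l.
rewrite natrD; have : 0 <= j0%:R :> R by []. have : 0 <= N%:R :> R by [].
by nra.
Qed.

Lemma rat_dense_ge0 (G : R -> R) a b : continuous G -> a < b ->
  (forall q : rat, a <= ratr q <= b -> 0 <= G (ratr q)) ->
  forall t, a <= t <= b -> 0 <= G t.
Proof.
move=> cG ab Gq t /andP[at_ tb]; rewrite leNgt; apply/negP => Gt.
have : \forall x \near t, G x < 0.
  exact: (cvgr_lt _ (cG t) _ Gt).
move=> /nbhs_ballP[e /= e0 He].
have lt_ : Num.max a (t - e) < Num.min b (t + e).
  by rewrite lt_min !gt_max; apply/andP; split; apply/andP; split; lra.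
have [q] := rat_in_itvoo lt_.
rewrite in_itv/= gt_max lt_min => /andP[/andP[q1 q2] /andP[q3 q4]].
have : G (ratr q) < 0 by apply: He; rewrite /ball/= ltr_distlC; apply/andP; split; lra.
by apply/negP; rewrite -leNgt; apply: Gq; rewrite !ltW.
Qed.

End RealLemmas.

(** * Convexity of the encoding function *)

Section Encoding.
Variables (R : realType) (s0 u0 t0 : R) (m : rat -> R) (Phi : R -> R).
Hypothesis hT : markov_tree s0 u0 t0 m.
Hypothesis hrising : rising m.
Hypothesis cPhi : continuous Phi.
Hypothesis Phi_ge0 : forall x : R, 0 <= x <= 1 -> 0 <= Phi x.
Hypothesis labelE : forall n k, (0 < n)%N -> (k <= n)%N -> coprime n k ->
  label m n k = 2 * Defs.cosh (n%:R * Phi (k%:R / n%:R)).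

Local Notation D := (discriminator s0 u0 t0).
Local Notation cosh := (@Defs.cosh R).

(* The homogeneous extension of [Phi] to the cone 0 <= k <= n. *)
Definition encF (n k : nat) : R := n%:R * Phi (k%:R / n%:R).

Lemma fracR_itv n k : (0 < n)%N -> (k <= n)%N -> 0 <= (k%:R / n%:R : R) <= 1.
Proof.
move=> n0 kn; rewrite divr_ge0 ?ler0n//=.
by rewrite ler_pdivrMr ?ltr0n// mul1r ler_nat.
Qed.

Lemma encF_ge0 n k : (0 < n)%N -> (k <= n)%N -> 0 <= encF n k.
Proof. by move=> n0 kn; rewrite mulr_ge0// Phi_ge0// fracR_itv. Qed.

Lemma encF_gt0 n k : (0 < n)%N -> (k <= n)%N -> coprime n k -> 0 < encF n k.
Proof.
move=> n0 kn c; rewrite lt_neqAle encF_ge0// andbT; apply/eqP => F0.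
have := label_gt2 hrising n0 kn; rewrite labelE// -/(encF n k) -F0.
by rewrite coshE2 oppr0 expR0; lra.
Qed.

Lemma encF_hom c n k : (0 < n)%N -> encF (c * n) (c * k) = c%:R * encF n k.
Proof.
move=> n0; rewrite /encF; case: c => [|c]; first by rewrite !mul0n !mul0r.
by rewrite !natrM -mulf_div divff ?pnatr_eq0// mul1r mulrA.
Qed.

Lemma farey_encF n k n' k' : farey n k n' k' ->
  [/\ 0 <= encF n k, 0 <= encF n' k', 0 <= encF (n + n') (k + k') &
  [/\ label m n k = 2 * cosh (encF n k), label m n' k' = 2 * cosh (encF n' k') &
   label m (n + n') (k + k') = 2 * cosh (encF (n + n') (k + k'))]].
Proof.
move=> F; have [n0 n'0 kn k'n' _] := fareyP F; have [c1 c2 c3] := farey_coprime F.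
have n''0 : (0 < n + n')%N by lia. have le : (k + k' <= n + n')%N by lia.
by split; [exact: encF_ge0..|split; exact: labelE].
Qed.

(** * Chord bounds over Farey intervals *)

Section Chord.
Variables (K : nat) (s : R) (h : nat -> nat -> R).
Hypothesis le_h : forall n k, (0 < n)%N -> (k <= n)%N -> s * encF n k <= h n k.
Hypothesis h_sub : forall n k n' k', farey n k n' k' -> (K <= n + n')%N ->
  h (n + n') (k + k') <= h n k + h n' k'.

(** Euclid's subtractive algorithm on [(c, d)]: [c v + d w] equals [c (v + w) + (d - c) w] and
    [(c - d) v + d (v + w)], over child pairs whose denominators only grow, so the bound [K]
    persists. The majorant [h] is kept apart from [s * encF] because the positivity of [Phi] needs a
    different one. *)
Lemma chord_nat n k n' k' c d : farey n k n' k' -> (K <= n + n')%N -> (0 < c + d)%N ->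
  s * encF (c * n + d * n') (c * k + d * k') <= c%:R * h n k + d%:R * h n' k'.
Proof.
have [N cdN] := ubnP (c + d).
elim: N => // N IH in n k n' k' c d cdN * => F Kn cd0.
have [n0 n'0 kn k'n' _] := fareyP F.
case: (posnP c) => [c0|c0].
  rewrite c0 !mul0n !add0n encF_hom// mul0r add0r mulrCA ler_wpM2l//; exact: le_h.
case: (posnP d) => [d0|d0].
  rewrite d0 !mul0n !addn0 encF_hom// mul0r addr0 mulrCA ler_wpM2l//; exact: le_h.
have hs := h_sub F Kn.
case: (leqP c d) => cd.
  have := IH _ _ _ _ c (d - c)%N _ (farey_right F).
  have -> : (c * (n + n') + (d - c) * n' = c * n + d * n')%N by nia.
  have -> : (c * (k + k') + (d - c) * k' = c * k + d * k')%N by nia.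
  move=> /(_ _ _ _)/le_trans; apply; [lia|lia|lia|].
  by rewrite natrB//; have : 0 <= c%:R :> R by []; nra.
have := IH _ _ _ _ (c - d)%N d _ (farey_left F).
have -> : ((c - d) * n + d * (n + n') = c * n + d * n')%N by nia.
have -> : ((c - d) * k + d * (k + k') = c * k + d * k')%N by nia.
move=> /(_ _ _ _)/le_trans; apply; [lia|lia|lia|].
by rewrite natrB ?(ltnW cd)//; have : 0 <= d%:R :> R by []; nra.
Qed.

Lemma chord_le n k n' k' (t : R) : farey n k n' k' -> (K <= n + n')%N ->
  k%:R <= n%:R * t -> n'%:R * t <= k'%:R ->
  s * Phi t <= (k'%:R - n'%:R * t) * h n k + (n%:R * t - k%:R) * h n' k'.
Proof.
move=> F Kn kt tk; have [n0 n'0 kn k'n' det] := fareyP F.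
have nR : (0 : R) < n%:R by rewrite ltr0n.
have nR' : (0 : R) < n'%:R by rewrite ltr0n.
have ab : (k%:R / n%:R : R) < k'%:R / n'%:R.
  rewrite ltr_pdivrMr// mulrAC ltr_pdivlMr// -!natrM ltr_nat; lia.
rewrite -subr_ge0.
pose G := fun t => (k'%:R - n'%:R * t) * h n k + (n%:R * t - k%:R) * h n' k' - s * Phi t.
apply: (rat_dense_ge0 (G := G) _ ab); last first.
- by rewrite ler_pdivrMr// ler_pdivlMr// ![t * _]mulrC kt tk.
- move=> q /andP[q1 q2].
  have q01 : 0 <= q <= 1.
    have /andP[z0 _] := fracR_itv n0 kn; have /andP[_ z1] := fracR_itv n'0 k'n'.
    by rewrite -(ler0q R) -(ler_rat R) rmorph1 (le_trans z0 q1) (le_trans q2 z1).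
  have [p [j [p0 jp _ qE]]] := fracP q01.
  move: q1 q2; rewrite qE ratr_frac.
  have pR : (0 : R) < p%:R by rewrite ltr0n.
  rewrite ler_pdivrMr// mulrAC ler_pdivlMr// -!natrM ler_nat => q1.
  rewrite ler_pdivrMr// mulrAC ler_pdivlMr// -!natrM ler_nat => q2.
  (* Cramer's rule for [c v + d w = (p, j)], the determinant being 1. *)
  have /= := @chord_nat n k n' k' (p * k' - j * n') (j * n - p * k) F Kn.
  have -> : ((p * k' - j * n') * n + (j * n - p * k) * n' = p)%N by nia.
  have -> : ((p * k' - j * n') * k + (j * n - p * k) * k' = j)%N by nia.
  rewrite !natrB; [|lia|lia]; rewrite !natrM /encF /G => /(_ _) H.
  rewrite subr_ge0 -(ler_pM2l pR).
  apply: le_trans (_ : _ <= s * (p%:R * Phi (j%:R / p%:R))) (le_trans (H _) _).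
  + by rewrite mulrCA.
  + by rewrite lt0n; apply/negP; rewrite addn_eq0 !subn_eq0 => /andP[]; nia.
  + rewrite le_eqVlt; apply/orP; left; apply/eqP; field; exact: lt0r_neq0.
- move=> x; rewrite /G; apply: cvgB; last first.
    by apply: cvgM; [exact: cvg_cst|exact: cPhi].
  apply: cvgD; apply: cvgM; try exact: cvg_cst; apply: cvgB; try exact: cvg_cst;
    apply: cvgM; try exact: cvg_cst; exact: cvg_id.
Qed.
End Chord.

(** An edge directed away from the root says [cosh a * cosh b < cosh c], so [ln (cosh F)] is
    superadditive for every value of D. It lies below F and is positive at the ends of a Farey
    interval, which keeps [Phi] positive at irrational points too. *)
Lemma Phi_gt0 (t : R) : 0 <= t <= 1 -> 0 < Phi t.
Proof.
move=> t01; have [tz|tz] := eqVneq t 0.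
  by have := @encF_gt0 1 0 isT isT isT; rewrite /encF mul1r mul0r tz.
have [to|to] := eqVneq t 1.
  by have := @encF_gt0 1 1 isT isT isT; rewrite /encF mul1r divr1 to.
have t01' : 0 < t < 1 by rewrite !lt_neqAle to eq_sym tz.
have [K edges] := rising_edges hrising.
case: (farey_descent K t01') => [[n [k [n' [k' [F Kn kt tk]]]]]|[n [k [n' [k' [F tE]]]]]].
  pose h n k := - ln (cosh (encF n k)).
  have le_h n1 k1 : (0 < n1)%N -> (k1 <= n1)%N -> -1 * encF n1 k1 <= h n1 k1.
    move=> n10 kn1; rewrite mulN1r lerN2 -[leRHS]expRK ler_ln ?posrE ?cosh_gt0 ?expR_gt0//.
    exact/cosh_le_expR/encF_ge0.
  have h_sub n1 k1 n1' k1' : farey n1 k1 n1' k1' -> (K <= n1 + n1')%N ->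
      h (n1 + n1')%N (k1 + k1')%N <= h n1 k1 + h n1' k1'.
    move=> F1 K1; rewrite /h -opprD lerN2 -lnM ?posrE ?cosh_gt0//.
    rewrite ler_ln ?posrE ?cosh_gt0//; last by apply: mulr_gt0; exact: cosh_gt0.
    have [_ _ _ [e1 e2 e3]] := farey_encF F1.
    by have := edges _ _ _ _ F1 K1; rewrite e1 e2 e3; lra.
  have := chord_le le_h h_sub F Kn (ltW kt) (ltW tk).
  rewrite mulN1r => H; rewrite -oppr_lt0; apply: (le_lt_trans H).
  have h_lt0 n1 k1 : (0 < n1)%N -> (k1 <= n1)%N -> coprime n1 k1 -> h n1 k1 < 0.
    move=> n10 kn1 c1; rewrite /h oppr_lt0 ln_gt0//.
    by have := label_gt2 hrising n10 kn1; rewrite labelE// -/(encF _ _); lra.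
  have [n0 n'0 kn k'n' det] := fareyP F; have [c1 c2 c3] := farey_coprime F.
  have := h_lt0 _ _ n0 kn c1; have := h_lt0 _ _ n'0 k'n' c2.
  by move: kt tk; nra.
have [n0 n'0 kn k'n' det] := fareyP F; have [c1 c2 c3] := farey_coprime F.
have nn0 : (0 < n + n')%N by lia. have le : (k + k' <= n + n')%N by lia.
have := encF_gt0 nn0 le c3; rewrite /encF -tE mulrAC divff ?pnatr_eq0 -?lt0n// mul1r.
by rewrite pmulr_rgt0 ?ltr0n.
Qed.

Lemma label_iter n k n' k' (E := expR (encF (n + n') (k + k'))) : farey n k n' k' ->
  forall j,
  label m (n + j * (n + n')) (k + j * (k + k')) =
    (label m n k * E - label m n' k') / (E - E^-1) * E ^+ j +
    (label m n' k' - label m n k / E) / (E - E^-1) * E ^- j /\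
  label m (n' + j * (n + n')) (k' + j * (k + k')) =
    (label m n' k' * E - label m n k) / (E - E^-1) * E ^+ j +
    (label m n k - label m n' k' / E) / (E - E^-1) * E ^- j.
Proof.
move=> F j; have [n0 n'0 kn k'n' _] := fareyP F; have [c1 c2 c3] := farey_coprime F.
have nn0 : (0 < n + n')%N by lia. have le : (k + k' <= n + n')%N by lia.
have E1 : 1 < E by rewrite /E expR_gt1 encF_gt0.
have uE : label m (n + n') (k + k') = E + E^-1.
  by rewrite labelE// -/(encF _ _) coshE2 expRN.
have [r1 r2] := label_rec hT F.
split.
- apply: (trace_recursion (X := fun j =>
    label m (n + j * (n + n')) (k + j * (k + k')))) => //.
  + by rewrite !mul0n !addn0.
  + by rewrite !mul1n r1 uE mulrC.
  + move=> i; have [F1 _] := farey_iter i F; have [_ e] := label_rec hT F1.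
    have iterS a b : (a + i.+2 * b = a + i * b + b + b)%N by lia.
    have iterS1 a b : (a + i.+1 * b = a + i * b + b)%N by lia.
    by rewrite !iterS !iterS1 -uE e mulrC.
- apply: (trace_recursion (X := fun j =>
    label m (n' + j * (n + n')) (k' + j * (k + k')))) => //.
  + by rewrite !mul0n !addn0.
  + by rewrite !mul1n -uE -r2 [in LHS]addnC [in X in label m _ X]addnC.
  + move=> i; have [_ F1] := farey_iter i F; have [e _] := label_rec hT F1.
    have iterS a b : (a + i.+2 * b = b + (b + (a + i * b)))%N by lia.
    have iterS1 a b : (a + i.+1 * b = b + (a + i * b))%N by lia.
    by rewrite !iterS !iterS1 -uE e.
Qed.

(* The sign [s] makes [s * Phi] convex. *)
Section Sign.
Variable s : R.
Hypothesis s_sign : s = 1 \/ s = -1.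
Hypothesis sD : 0 < s * (4 - D).

(** The direction of the edge makes [z] exceed [cosh (a + b) + cosh (a - b)], so the factor
    [z - 2 cosh (a - b)] is positive and the other factor has the sign of D - 4. *)
Lemma encF_subadd n k n' k' : farey n k n' k' ->
  label m n k * label m n' k' < 2 * label m (n + n') (k + k') ->
  s * encF (n + n') (k + k') <= s * encF n k + s * encF n' k'.
Proof.
move=> F; have := label_discriminator hT F.
have [a0 b0 c0 [-> -> ->]] := farey_encF F.
set a := encF n k in a0 *; set b := encF n' k' in b0 *.
set c := encF (n + n')%N (k + k')%N in c0 *.
move=> DE edge; have := cosh_quadratic a b (2 * cosh c).
have -> : (2 * cosh a) ^+ 2 + (2 * cosh b) ^+ 2 + (2 * cosh c) ^+ 2
   - 2 * cosh a * (2 * cosh b) * (2 * cosh c) - 4 = D - 4 by rewrite -DE; ring.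
have ab := coshM a b; have cs := cosh_sub_le a0 b0.
have w0 : 0 < 2 * cosh c - 2 * cosh (a - b) by nra.
move=> D4; have : 0 < s * (2 * cosh (a + b) - 2 * cosh c).
  rewrite -(pmulr_lgt0 _ w0); move: sD; congr (0 < _).
  by rewrite -opprB D4; ring.
have ab0 : 0 <= a + b by rewrite addr_ge0.
case: s_sign => -> H.
  by rewrite !mul1r ltW// (@ltr_cosh_inv _ c)//; lra.
by rewrite !mulN1r -opprD lerN2 ltW// (@ltr_cosh_inv _ _ c)//; lra.
Qed.

(** Multiplying the two bounds gives [A * B <= 1] for [s = 1] and [A * B >= 1] for [s = -1]. For
    [s = 1], both coefficients are positive because their sum and product are. *)
Lemma sign_contradiction (A B E t t' : R) : 0 < E -> 0 < t -> 0 < t' -> t * t' = E ->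
  0 < A + B -> s * (A - t) <= 0 -> s * (B * E - t') <= 0 -> 0 < s * (A * B - 1) -> False.
Proof.
move=> E0 tp tp' tt' AB0.
case: s_sign => ->; rewrite ?mul1r ?mulN1r => sA sB AB1.
  have A0 : 0 < A by nra.
  have B0 : 0 < B by nra.
  have : A * (B * E) <= t * t'.
    have BE : 0 <= B * E by rewrite mulr_ge0 ?ltW.
    by apply: ler_pM; lra.
  by rewrite tt'; nra.
have : t * t' <= A * (B * E) by apply: ler_pM; lra.
by rewrite tt'; nra.
Qed.

(* [Phi] has a strict corner at every rational of (0, 1): along v + j u and
   w + j u, where u = v + w, the labels are combinations of e^(ja) and e^(-ja)
   with a = F(u), and their leading coefficients multiply to e^a times
   1 - (D - 4) / (4 sinh^2 a). *)
Lemma no_touch_frac p q (x y al be : R) : (0 < q < p)%N -> coprime p q ->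
  x < q%:R / p%:R < y ->
  Phi (q%:R / p%:R) = al + be * (q%:R / p%:R) ->
  (forall t : R, 0 <= t <= 1 -> x <= t <= y -> s * Phi t <= s * (al + be * t)) -> False.
Proof.
move=> qp cpq /andP[xz zy] zE below.
have [n [k [n' [k' [F pE qE]]]]] := rat_mediant R qp cpq; subst p q.
have [n0 n'0 kn k'n' det] := fareyP F; have [c1 c2 c3] := farey_coprime F.
have nn0 : (0 < n + n')%N by lia. have le : (k + k' <= n + n')%N by lia.
set z := _ / _ in xz zy zE.
have nnR : (0 : R) < (n + n')%:R by rewrite ltr0n.
set a := encF (n + n') (k + k').
have a0 : 0 < a by rewrite encF_gt0.
have aE : a = al * (n + n')%:R + be * (k + k')%:R.
  rewrite /a /encF -/z zE /z; field; rewrite -natrD lt0r_neq0//.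
pose E := expR a; have E0 : 0 < E := expR_gt0 _.
have E1 : 1 < E by rewrite /E expR_gt1.
have detR : n%:R * (k' %:R) = k%:R * n'%:R + 1 :> R.
  by rewrite -!natrM det natrD.
(* Values of the line, made homogeneous, at the two Farey parents; they add up to [a] because the
   line passes through the touching point. *)
pose tau := al * n%:R + be * k%:R; pose tau' := al * n'%:R + be * k'%:R.
have tauE : tau + tau' = a by rewrite aE !natrD /tau /tau'; ring.
(* From [j0] on, the fractions lie in [[x, y]] and the homogeneous line is nonnegative at them, as
   the monotonicity of [cosh] requires. *)
pose j0 := (Num.bound (Num.max (z - x)^-1 (y - z)^-1) +
            Num.bound (Num.max (`|tau| / a) (`|tau'| / a)))%N.
have j0P j : (j0 <= j)%N -> [/\ 0 < j%:R :> R, j%:R^-1 <= z - x, j%:R^-1 <= y - z,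
    0 <= tau + j%:R * a & 0 <= tau' + j%:R * a].
  move=> jj; have : Num.max (z - x)^-1 (y - z)^-1 < j%:R.
    apply: (lt_le_trans (archi_boundP _)); first by rewrite le_max !invr_ge0 subr_ge0 ltW.
    by rewrite ler_nat (leq_trans _ jj)// leq_addr.
  have : Num.max (`|tau| / a) (`|tau'| / a) < j%:R.
    apply: (lt_le_trans (archi_boundP _)); first by rewrite le_max divr_ge0// ltW.
    by rewrite ler_nat (leq_trans _ jj)// leq_addl.
  rewrite !gt_max !ltr_pdivrMr// => /andP[t1 t2] /andP[j1 j2].
  have jp : 0 < j%:R :> R by apply: lt_trans j1; rewrite invr_gt0 subr_gt0.
  split=> //.
  - by rewrite invf_ple ?posrE ?subr_gt0// ltW.
  - by rewrite invf_ple ?posrE ?subr_gt0// ltW.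
  - by have := ler_norm (- tau); rewrite normrN; lra.
  - by have := ler_norm (- tau'); rewrite normrN; lra.
have cmp v1 v2 b : (0 < v1)%N -> (v2 <= v1)%N -> coprime v1 v2 ->
    x <= v2%:R / v1%:R <= y -> b = al * v1%:R + be * v2%:R -> 0 <= b ->
    s * label m v1 v2 <= s * (expR b + expR (- b)).
  move=> v10 v21 c12 v12 bE b0.
  have := below _ (fracR_itv v10 v21) v12.
  have v1R : (0 : R) < v1%:R by rewrite ltr0n.
  rewrite -(ler_pM2l v1R) labelE// -coshE2.
  have -> : v1%:R * (s * Phi (v2%:R / v1%:R)) = s * encF v1 v2 by rewrite mulrCA.
  have -> : v1%:R * (s * (al + be * (v2%:R / v1%:R))) = s * b.
    by rewrite bE; field; exact: lt0r_neq0.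
  rewrite -/(encF v1 v2); have F0 := encF_ge0 v10 v21.
  case: s_sign => ->; rewrite ?mul1r ?mulN1r ?lerN2 => H; rewrite ler_pM2l//;
    exact: ler_cosh.
have expj b j : expR (b + j%:R * a) = expR b * E ^+ j.
  by rewrite expRD expRM_natl.
(* With determinant 1 or -1, [d / c] lies at distance [1 / ((n + n') * c)] from [z]. *)
have itv j c d : (0 < c)%N -> (n + n')%:R * d%:R = (k + k')%:R * c%:R + 1 :> R \/
    (n + n')%:R * d%:R = (k + k')%:R * c%:R - 1 :> R ->
    (j <= c)%N -> (j0 <= j)%N -> x <= d%:R / c%:R <= y.
  move=> c0 dc jc jj; have [jp jx jy _ _] := j0P j jj.
  have cR : 0 < c%:R :> R by rewrite ltr0n.
  have inv0 : 0 < ((n + n')%:R * c%:R)^-1 :> R by rewrite invr_gt0 mulr_gt0.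
  have inv : ((n + n')%:R * c%:R)^-1 <= j%:R^-1 :> R.
    by rewrite lef_pV2 ?posrE ?mulr_gt0// -natrM ler_nat (leq_trans jc)// leq_pmull.
  have : d%:R / c%:R = z + ((n + n')%:R * c%:R)^-1 \/
         d%:R / c%:R = z - ((n + n')%:R * c%:R)^-1.
    have -> : d%:R / c%:R = ((n + n')%:R * d%:R) / ((n + n')%:R * c%:R) :> R.
      by field; rewrite -natrD !lt0r_neq0.
    by case: dc => ->; [left|right]; rewrite /z; field; rewrite -natrD !lt0r_neq0.
  by case=> ->; apply/andP; split; lra.
pose A := (label m n k * E - label m n' k') / (E - E^-1).
pose B := (label m n' k' - label m n k / E) / (E - E^-1).
have nz : (E != 0) && (E * E - 1 != 0).
  by rewrite !gt_eqF// subr_gt0 -expr2 exprn_egt1.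
have sA : s * (A - expR tau) <= 0.
  apply: (@exp_unbounded _ E _ (s * ((expR tau)^-1 - B)) j0 E1) => j jj.
  have [jp _ _ tj _] := j0P j jj.
  have [F1 _] := farey_iter j F; have [c1' _ _] := farey_coprime F1.
  have [m0 _ mk _ _] := fareyP F1.
  have := cmp _ _ (tau + j%:R * a) m0 mk c1' _ _ tj.
  rewrite (label_iter F j).1 -/a -/E -/A -/B expRN expj => H.
  have {H} : s * (A * E ^+ j + B * E ^- j) <=
      s * (expR tau * E ^+ j + (expR tau * E ^+ j)^-1).
    apply: H; last by rewrite aE !natrD !natrM !natrD /tau; ring.
    apply: (itv j) => //; last by rewrite (leq_trans (leq_pmulr j nn0))// leq_addl.
    right; rewrite !natrD !natrM !natrD; move: detR; nra.
  by rewrite invfM !mulrBr !mulrBl !mulrDr; lra.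
have sB : s * (B * E - expR tau') <= 0.
  apply: (@exp_unbounded _ E _ (s * ((expR tau')^-1 - A / E)) j0 E1) => j jj.
  have [jp _ _ _ tj] := j0P j jj.
  have [_ F1] := farey_iter j F; have [_ c1' _] := farey_coprime F1.
  have [_ m0 _ mk _] := fareyP F1.
  have := cmp _ _ (tau' + j%:R * a) m0 mk c1' _ _ tj.
  rewrite (label_iter F j).2 -/a -/E.
  have -> : (label m n' k' * E - label m n k) / (E - E^-1) = B * E.
    by rewrite /B; field.
  have -> : (label m n k - label m n' k' / E) / (E - E^-1) = A / E.
    by rewrite /A; field.
  rewrite expRN expj => H.
  have {H} : s * (B * E * E ^+ j + A / E * E ^- j) <=
      s * (expR tau' * E ^+ j + (expR tau' * E ^+ j)^-1).
    apply: H; last by rewrite aE !natrD !natrM !natrD /tau'; ring.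
    apply: (itv j) => //; last by rewrite (leq_trans (leq_pmulr j nn0))// leq_addl.
    left; rewrite !natrD !natrM !natrD; move: detR; nra.
  by rewrite invfM !mulrBr !mulrBl !mulrDr; lra.
have tt' : expR tau * expR tau' = E by rewrite -expRD tauE.
have X2 := label_gt2 hrising n0 kn.
have AB : A + B = label m n k by rewrite /A /B; field.
have DE : (E - E^-1) ^+ 2 * (1 - A * B) = D - 4.
  have := label_discriminator hT F.
  rewrite (labelE nn0 le c3) -/(encF _ _) -/a coshE2 expRN -/E => <-.
  by rewrite /A /B; field.
have d2 : 0 < (E - E^-1) ^+ 2.
  by rewrite exprn_gt0// subr_gt0 (lt_trans _ E1)// invf_lt1.
have t0' := expR_gt0 tau; have t1' := expR_gt0 tau'.
have AB1 : 0 < s * (A * B - 1).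
  rewrite -(pmulr_rgt0 _ d2); move: sD; congr (0 < _).
  by rewrite -[4 - D]opprB -DE; ring.
apply: (sign_contradiction E0 t0' t1' tt' _ sA sB AB1).
by rewrite AB; apply: lt_trans X2.
Qed.

(* A touching point z is itself a fraction or lies inside a short Farey interval
   whose chord bounds [s * Phi] from above; then the chord touches the line too,
   at both ends. *)
Lemma no_touch (x y z al be : R) : 0 <= x -> y <= 1 -> x < z < y ->
  Phi z = al + be * z ->
  (forall t : R, x <= t <= y -> s * Phi t <= s * (al + be * t)) -> False.
Proof.
move=> x0 y1 /andP[xz zy] zE below.
have z01 : 0 < z < 1 by apply/andP; split; lra.
have [K edges] := rising_edges hrising.
have g0 : 0 < Num.min (z - x) (y - z) by rewrite lt_min !subr_gt0 xz.
(* A Farey interval around [z] of length at most [1 / N] stays inside [[x, y]]. *)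
pose N := Num.bound (Num.min (z - x) (y - z))^-1.
have NP : (Num.min (z - x) (y - z))^-1 < N%:R by rewrite archi_boundP// invr_ge0 ltW.
have N0 : 0 < N%:R :> R by apply: lt_trans NP; rewrite invr_gt0.
have : N%:R^-1 < Num.min (z - x) (y - z) by rewrite invf_plt ?posrE.
rewrite lt_min => /andP[Nx Ny].
case: (farey_descent (K + N).+1 z01) => [|[n [k [n' [k' [F tE]]]]]]; last first.
  have [n0 n'0 kn k'n' det] := fareyP F; have [c1 c2 c3] := farey_coprime F.
  have [k'0 kn'] := farey_lt F.
  have nnz : (n + n')%:R != 0 :> R by rewrite pnatr_eq0 -lt0n addn_gt0 n0.
  have zE' : z = (k + k')%:R / (n + n')%:R by rewrite -tE mulrAC divff// mul1r.
  apply: (@no_touch_frac (n + n') (k + k') x y al be) => //; rewrite -?zE' ?xz//.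
    by rewrite addn_gt0 k'0 orbT /= (leq_add kn' k'n').
  by move=> t _; exact: below.
move=> [n [k [n' [k' [F Kn kz zk]]]]].
have [n0 n'0 kn k'n' det] := fareyP F; have [c1 c2 c3] := farey_coprime F.
have nR : (0 : R) < n%:R by rewrite ltr0n.
have nR' : (0 : R) < n'%:R by rewrite ltr0n.
have detR : n%:R * (k' %:R) = k%:R * n'%:R + 1 :> R.
  by rewrite -!natrM det natrD.
have nn : (n%:R * n'%:R)^-1 <= N%:R^-1 :> R.
  rewrite lef_pV2 ?posrE ?mulr_gt0// -natrM ler_nat -(leq_add2r 1).
  by rewrite (leq_trans _ (addn_le_muln n0 n'0))// (leq_trans _ Kn)// addn1 ltnS leq_addl.
have gap : k'%:R / n'%:R - k%:R / n%:R = (n%:R * n'%:R)^-1 :> R.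
  have -> : k'%:R / n'%:R - k%:R / n%:R = (n%:R * k'%:R - k%:R * n'%:R) / (n%:R * n'%:R) :> R.
    by field; rewrite !lt0r_neq0.
  by rewrite detR addrC addKr mul1r.
have kz' : k%:R / n%:R < z by rewrite ltr_pdivrMr// mulrC.
have zk' : z < k'%:R / n'%:R by rewrite ltr_pdivlMr// mulrC.
have xv : x < k%:R / n%:R by lra.
have wy : k'%:R / n'%:R < y by lra.
have := chord_le (s := s) (h := fun n k => s * encF n k) (K := K) _ _ F _ (ltW kz) (ltW zk).
move=> /(_ (fun _ _ _ _ => lexx _)) H.
have {H} : s * Phi z <= (k'%:R - n'%:R * z) * (s * encF n k) + (n%:R * z - k%:R) * (s * encF n' k').
  apply: H; last exact: leq_trans (leqW (leq_addr N K)) Kn.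
  by move=> n1 k1 n1' k1' F1 K1; apply: encF_subadd => //; exact: edges.
have bv v1 v2 : (0 < v1)%N -> x < v2%:R / v1%:R < y ->
    s * encF v1 v2 <= s * (al * v1%:R + be * v2%:R).
  move=> v10 /andP[v_ v']; have v1R : (0 : R) < v1%:R by rewrite ltr0n.
  have /below : x <= v2%:R / v1%:R <= y by rewrite !ltW.
  rewrite -(ler_pM2l v1R) mulrCA => /le_trans; apply.
  rewrite le_eqVlt; apply/orP; left; apply/eqP; field; exact: lt0r_neq0.
have bk : s * encF n k <= s * (al * n%:R + be * k%:R).
  by apply: bv => //; rewrite xv; lra.
have bk' : s * encF n' k' <= s * (al * n'%:R + be * k'%:R).
  by apply: bv => //; rewrite wy andbT; lra.
move=> H.
(* The chord at [z] is a positively weighted sum of its end values, none of them above the line;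
   since it reaches the line there, the left end value cannot be strictly below. *)
have eqk : s * encF n k = s * (al * n%:R + be * k%:R).
  apply/eqP; rewrite eq_le bk/= leNgt; apply/negP => lt_.
  have : (k'%:R - n'%:R * z) * (s * encF n k) <
         (k'%:R - n'%:R * z) * (s * (al * n%:R + be * k%:R)) by rewrite ltr_pM2l// subr_gt0.
  have : (n%:R * z - k%:R) * (s * encF n' k') <=
         (n%:R * z - k%:R) * (s * (al * n'%:R + be * k'%:R)) by rewrite ler_pM2l// subr_gt0.
  suff : s * Phi z = (k'%:R - n'%:R * z) * (s * (al * n%:R + be * k%:R)) +
     (n%:R * z - k%:R) * (s * (al * n'%:R + be * k'%:R)) by lra.
  rewrite zE; have -> : (k'%:R - n'%:R * z) * (s * (al * n%:R + be * k%:R)) +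
     (n%:R * z - k%:R) * (s * (al * n'%:R + be * k'%:R)) =
     s * (al + be * z) * (n%:R * k'%:R - k%:R * n'%:R) by ring.
  by rewrite detR; ring.
have s0' : s != 0 by case: s_sign => ->; rewrite ?oppr_eq0 oner_eq0.
have kp : (0 < k)%N.
  by rewrite lt0n; apply/eqP => k_0; move: xv; rewrite k_0 mul0r; lra.
apply: (@no_touch_frac n k x y al be) => //.
- by rewrite kp; have [] := farey_lt F.
- by rewrite xv; lra.
- move/(mulfI s0'): eqk; rewrite /encF => eqk.
  by apply: (mulfI (lt0r_neq0 nR)); rewrite eqk; field; exact: lt0r_neq0.
- by move=> t _; exact: below.
Qed.

(** Otherwise [s * Phi] minus its chord vanishes at the ends and is nonnegative at [z], so it
    reaches its maximum inside; the chord shifted by that maximum touches [Phi] from the wrong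
    side. *)
Lemma strictly_convex (x y z : R) : 0 <= x -> y <= 1 -> x < z < y ->
  (y - x) * (s * Phi z) < (y - z) * (s * Phi x) + (z - x) * (s * Phi y).
Proof.
move=> x0 y1 /andP[xz zy]; have xy : x < y by lra.
have yx : y - x != 0 by rewrite subr_eq0 gt_eqF.
rewrite ltNge; apply/negP => above.
pose be := (Phi y - Phi x) / (y - x); pose al := Phi x - be * x.
pose g t := s * Phi t - s * (al + be * t).
have gx : g x = 0 by rewrite /g /al; ring.
have gy : g y = 0 by rewrite /g /al /be; field.
have gz : 0 <= g z.
  rewrite -(@pmulr_rge0 _ (y - x)) ?subr_gt0//.
  have -> : (y - x) * g z = (y - x) * (s * Phi z) -
      ((y - z) * (s * Phi x) + (z - x) * (s * Phi y)) by rewrite /g /al /be; field.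
  by rewrite subr_ge0.
have cg : continuous g.
  move=> t; apply: cvgB; first by apply: cvgM; [exact: cvg_cst|exact: cPhi].
  apply: cvgM; first exact: cvg_cst.
  by apply: cvgD; [exact: cvg_cst|apply: cvgM; [exact: cvg_cst|exact: cvg_id]].
have [c /itvP cxy cmax] := EVT_max (ltW xy) (continuous_subspaceT cg).
have touch d : x < d < y -> (forall t, x <= t <= y -> g t <= g d) -> False.
  move=> xdy dmax; have ss : s * s = 1 by case: s_sign => ->; ring.
  apply: (@no_touch x y d (al + s * g d) be) => //.
    rewrite /g -addrA addrCA; transitivity (s * s * Phi d); first by rewrite ss mul1r.
    by rewrite mulrBr !mulrA ss; ring.
  move=> t /dmax; rewrite {1}/g => H.
  have -> : s * (al + s * g d + be * t) = s * (al + be * t) + s * s * g d by ring.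
  by rewrite ss; lra.
(* A maximum found at an end is 0, and then [z] attains it as well. *)
have [cx|cx] := eqVneq c x.
  apply: (touch z); first by rewrite xz.
  move=> t txy; apply: (le_trans (cmax t _)); first by rewrite in_itv.
  by rewrite cx gx.
have [cy|cy] := eqVneq c y.
  apply: (touch z); first by rewrite xz.
  move=> t txy; apply: (le_trans (cmax t _)); first by rewrite in_itv.
  by rewrite cy gy.
apply: (touch c); first by rewrite !lt_neqAle eq_sym cx cy !cxy.
by move=> t txy; apply: cmax; rewrite in_itv.
Qed.

End Sign.

(** The product formula for [cosh] propagates [2 cosh L], with [L] linear, from the root to all
    labels. Hence [Phi] is the absolute value of an affine function, and positivity of [Phi] forces
    that function to keep one sign. *)
Lemma Phi_affine : D = 4 -> exists al be : R, forall t, 0 <= t <= 1 -> Phi t = al + be * t.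
Proof.
move=> D4.
have coshN x : cosh (- x) = cosh x by rewrite /Defs.cosh opprK addrC.
have [al [be L0]] : exists al be : R, [/\ label m 1 0 = 2 * cosh al,
    label m 1 1 = 2 * cosh (al + be) & label m 2 1 = 2 * cosh (2 * al + be)].
  have [a0 b0 c0 [e1 e2 e3]] := farey_encF farey_root.
  have := label_discriminator hT farey_root; rewrite D4 e1 e2 e3 => /eqP.
  rewrite -subr_eq0 cosh_quadratic mulf_eq0 !subr_eq0 => /orP rt.
  have [|b' [bb' ->]] := cosh_root (c := encF (1 + 1) (0 + 1)) a0 b0.
    by case: rt => /eqP; [left|right].
  exists (encF 1 0), (b' - encF 1 0); split=> //.
    rewrite addrC subrK -bb'; congr (2 * _).
    by case: (ler0P b') => _ //; rewrite coshN.
  by congr (2 * cosh _); ring.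
pose L n k := al * n%:R + be * k%:R.
have LE n k n' k' : farey n k n' k' -> [/\ label m n k = 2 * cosh (L n k),
   label m n' k' = 2 * cosh (L n' k') &
   label m (n + n') (k + k') = 2 * cosh (L (n + n')%N (k + k')%N)].
  elim=> {n k n' k'} [|n k n' k' F [e1 e2 e3]|n k n' k' F [e1 e2 e3]].
  - case: L0 => -> -> ->; rewrite /L /= !mulr1 !mulr0 addr0; split=> //.
    by congr (2 * cosh _); ring.
  - split=> //; have [-> _] := label_rec hT F; rewrite e1 e2 e3.
    have := coshM (L (n + n')%N (k + k')%N) (L n k).
    have -> : L (n + n')%N (k + k')%N + L n k = L (n + (n + n'))%N (k + (k + k'))%N.
      by rewrite /L !natrD; ring.
    have -> : L (n + n')%N (k + k')%N - L n k = L n' k' by rewrite /L !natrD; ring.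
    by lra.
  - split=> //; have [_ ->] := label_rec hT F; rewrite e1 e2 e3.
    have := coshM (L (n + n')%N (k + k')%N) (L n' k').
    have -> : L (n + n')%N (k + k')%N + L n' k' = L (n + n' + n')%N (k + k' + k')%N.
      by rewrite /L !natrD; ring.
    have -> : L (n + n')%N (k + k')%N - L n' k' = L n k by rewrite /L !natrD; ring.
    by lra.
have cosh_inj x y : 0 <= x -> cosh x = cosh y -> x = `|y|.
  move=> x0; have -> : cosh y = cosh `|y| by case: (ler0P y) => _ //; rewrite coshN.
  move=> e; have [lt_|lt_|//] := ltgtP x `|y|.
    by have := ltr_cosh x0 lt_; rewrite e ltxx.
  by have := ltr_cosh (normr_ge0 y) lt_; rewrite e ltxx.
have PhiQ n k : (0 < n)%N -> (k <= n)%N -> coprime n k ->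
    Phi (k%:R / n%:R) = `|al + be * (k%:R / n%:R)|.
  move=> n0 kn c; have nR : (0 : R) < n%:R by rewrite ltr0n.
  have : label m n k = 2 * cosh (L n k).
    have [k0|k0] := posnP k.
      move: c; rewrite k0 /coprime gcdn0 => /eqP ->; by have [] := LE _ _ _ _ farey_root.
    have [kn'|kn'|kn'] := ltngtP k n; [|lia|].
      have [|v1 [v2 [w1 [w2 [F -> ->]]]]] := rat_mediant R _ c; first by rewrite k0.
      by have [] := LE _ _ _ _ F.
    move: c; rewrite kn' /coprime gcdnn => /eqP ->; by have [] := LE _ _ _ _ farey_root.
  rewrite labelE// => /(mulfI _) e; apply: (mulfI (lt0r_neq0 nR)).
  have -> : n%:R * Phi (k%:R / n%:R) = `|L n k|.
    by apply: cosh_inj (encF_ge0 n0 kn) (e _); rewrite pnatr_eq0.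
  have -> : n%:R * `|al + be * (k%:R / n%:R)| = `|n%:R * (al + be * (k%:R / n%:R))|.
    by rewrite normrM gtr0_norm.
  have -> // : L n k = n%:R * (al + be * (k%:R / n%:R)).
  by rewrite /L; field; exact: lt0r_neq0.
have cl : continuous (fun t : R => `|al + be * t|).
  move=> t; apply: (cvg_norm (f := fun t => al + be * t)).
  by apply: cvgD; [exact: cvg_cst|apply: cvgM; [exact: cvg_cst|exact: cvg_id]].
have PhiE t : 0 <= t <= 1 -> Phi t = `|al + be * t|.
  move=> t01; apply/eqP; rewrite eq_le -subr_ge0 -[_ <= Phi t]subr_ge0.
  apply/andP; split.
    apply: (rat_dense_ge0 (G := fun t => `|al + be * t| - Phi t) _ ltr01 _ t01).
      by move=> x; apply: cvgB; [exact: cl|exact: cPhi].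
    move=> q; rewrite -[0 in X in X -> _](rmorph0 (@ratr R)) -[1 in X in X -> _](rmorph1 (@ratr R)).
    rewrite !ler_rat => /fracP[n [k [n0 kn c ->]]].
    by rewrite ratr_frac PhiQ// subrr.
  apply: (rat_dense_ge0 (G := fun t => Phi t - `|al + be * t|) _ ltr01 _ t01).
    by move=> x; apply: cvgB; [exact: cPhi|exact: cl].
  move=> q; rewrite -[0 in X in X -> _](rmorph0 (@ratr R)) -[1 in X in X -> _](rmorph1 (@ratr R)).
  rewrite !ler_rat => /fracP[n [k [n0 kn c ->]]].
  by rewrite ratr_frac PhiQ// subrr.
have nz t : 0 <= t <= 1 -> al + be * t != 0.
  by move=> t01; rewrite -normr_eq0 -PhiE// lt0r_neq0// Phi_gt0.
have al0 : al != 0 by have := nz 0; rewrite mulr0 addr0 lexx ler01; apply.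
have same t : 0 <= t <= 1 -> 0 < al * (al + be * t).
  move=> /andP[t0' t1']; rewrite ltNge; apply/negP => le0.
  have d0 : 0 < al * al - al * (al + be * t).
    have al2 : 0 < al * al by rewrite -expr2 exprn_even_gt0.
    by lra.
  (* [r * t] is the zero of the affine function between 0 and [t]. *)
  pose r := al * al / (al * al - al * (al + be * t)).
  have r01 : 0 <= r <= 1.
    apply/andP; split; last by rewrite /r ler_pdivrMr// mul1r; lra.
    by rewrite /r divr_ge0 ?(ltW d0)// -expr2 sqr_ge0.
  have rt01 : 0 <= r * t <= 1.
    by case/andP: r01 => r0 r1; rewrite mulr_ge0//= mulr_ile1.
  have /eqP := nz _ rt01; apply.
  apply: (mulfI al0); rewrite mulr0 /r; field; exact: lt0r_neq0.
case: (ltgtP 0 al) al0 => // al0 _.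
  exists al, be => t t01; rewrite PhiE// ger0_norm//.
  by have := same _ t01; rewrite pmulr_rgt0// => /ltW.
exists (- al), (- be) => t t01; rewrite PhiE// ler0_norm//; first by ring.
by have := same _ t01; rewrite nmulr_rgt0// => /ltW.
Qed.

End Encoding.

(** * Sequences, index points and slopes *)

Section Sequences.
Variables (d : Order.disp_t) (T : orderType d) (R : realType).
Variables (S : set T) (f : T -> R) (c : T -> nat).
Hypothesis cP : forall i j, S i -> S j -> (i < j)%O = (c i < c j)%N.

(** The code embeds [S] in the natural numbers, so predecessors and least elements exist even when
    [S] is infinite. *)
Let pred_ex i j : S i -> S j -> (i < j)%O -> exists r, consecutive_in S r j.
Proof.
move=> Si Sj ij.
pose Q n := `[< exists r, [/\ S r, (r < j)%O & c r = n] >].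
have exQ : exists n, Q n by exists (c i); apply/asboolP; exists i.
have ubQ n : Q n -> (n <= c j)%N.
  by move=> /asboolP[r [Sr]]; rewrite cP// => /ltnW + <-.
have [r [Sr rj rE]] : exists r, [/\ S r, (r < j)%O & c r = ex_maxn exQ ubQ].
  by case: ex_maxnP => n /asboolP.
exists r; split=> // -[k Sk /andP[rk kj]].
move: rE rk; case: ex_maxnP => n _ nmax rE; rewrite cP// rE ltnNge nmax//.
by apply/asboolP; exists k.
Qed.

Let min_ex (A : set T) : A `<=` S -> A !=set0 ->
  exists2 r, A r & forall i, A i -> (r <= i)%O.
Proof.
move=> AS [i0 Ai0]; pose Q n := `[< exists2 r, A r & c r = n >].
have exQ : exists n, Q n by exists (c i0); apply/asboolP; exists i0.
have [r Ar rE] : exists2 r, A r & c r = ex_minn exQ by case: ex_minnP => n /asboolP.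
exists r => // i Ai; rewrite leNgt; apply/negP; rewrite cP; try exact: AS.
rewrite rE; case: ex_minnP => n _ nmin; rewrite ltnNge nmin//.
by apply/asboolP; exists i.
Qed.

(* The descent starts at the first element that is not above all its predecessors. *)
Lemma modal_of_quasiconcave :
  (forall i j k, S i -> S j -> S k -> (i < j)%O -> (j < k)%O ->
     Num.min (f i) (f k) < f j) ->
  modal_on S f.
Proof.
move=> qc.
pose A := [set j | S j /\ exists i, [/\ S i, (i < j)%O & f j <= f i]].
have [A0|/set0P/negP/negPn/eqP A0] := pselect (A !=set0); last first.
  left; left=> i j Si Sj ij; rewrite ltNge; apply/negP => fji.
  by have : A j by [split=> //; exists i]; rewrite A0.
have AS : A `<=` S by move=> j [].
have [r' [Sr' [i0 [Si0 i0r fi0]]] r'min] := min_ex AS A0.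
have [r cons] := pred_ex Si0 Sr' i0r; have [Sr _ rr' nb] := cons.
have incr : increasing_on (S `&` [set i | (i <= r)%O]) f.
  move=> i j [Si ir] [Sj jr] ij; rewrite ltNge; apply/negP => fji.
  have : (r' <= j)%O by apply: r'min; split=> //; exists i.
  by rewrite leNgt (le_lt_trans jr rr').
have i0r' : (i0 <= r)%O.
  by rewrite leNgt; apply/negP => ri0; apply: nb; exists i0; rewrite ?ri0.
have fr : f r' <= f r.
  apply: (le_trans fi0); move: i0r'; rewrite le_eqVlt => /predU1P[->//|lt_].
  by apply/ltW/incr => //; split=> //=; exact: ltW.
have after j : S j -> (r' < j)%O -> f j < f r'.
  move=> Sj r'j; have := qc _ _ _ Sr Sr' Sj rr' r'j.
  by rewrite gt_min => /orP[]//; rewrite ltNge fr.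
have decr : decreasing_on (S `&` [set i | (r' <= i)%O]) f.
  move=> i j [Si ir] [Sj jr] ij; move: ir; rewrite /= le_eqVlt => /predU1P[r'i|r'i].
    by rewrite -r'i; apply: after => //; rewrite r'i.
  have := qc _ _ _ Sr' Si Sj r'i ij.
  by rewrite gt_min => /orP[]//; rewrite ltNge ltW//; exact: after.
(* A tie makes [r], [r'] the middle pair of the definition. Otherwise the peak is [r], and the
   middle pair must be moved back to end at [r], unless [r] is the first element. *)
move: fr; rewrite le_eqVlt => /predU1P[fr|fr].
  by right; exists r, r'; split=> //; rewrite fr.
have decr' : decreasing_on (S `&` [set i | (r <= i)%O]) f.
  move=> i j [Si ir] [Sj jr] ij.
  have jr' : (r' <= j)%O.
    rewrite leNgt; apply/negP => jr'; apply: nb; exists j => //.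
    by rewrite jr' (le_lt_trans ir ij).
  move: ir; rewrite /= le_eqVlt => /predU1P[ri|ri].
    rewrite -ri; move: jr'; rewrite le_eqVlt => /predU1P[<-//|r'j].
    exact: lt_trans (after _ Sj r'j) fr.
  apply: decr => //; split=> //=.
  by rewrite leNgt; apply/negP => ir'; apply: nb; exists i; rewrite ?ri.
have [[i Si ir]|first] := pselect (exists2 i, S i & (i < r)%O); last first.
  left; right => i j Si Sj; apply: decr'; split=> //=; rewrite leNgt; apply/negP => lt_;
    by apply: first; eexists; last exact: lt_.
have [q cq] := pred_ex Si Sr ir; have [Sq _ qr _] := cq.
right; exists q, r; split=> //.
- move=> i1 j1 [Si1 i1q] [Sj1 j1q]; apply: incr; split=> //=; apply: ltW.
    exact: le_lt_trans i1q qr.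
  exact: le_lt_trans j1q qr.
- by apply/ltW/incr => //; split=> //=; exact: ltW.
Qed.

End Sequences.

(** * Index points as coprime pairs in lexicographic order *)

Section IndexPoints.
Variables (R : realType) (m : rat -> R).
Implicit Type l : set (R * R).

Lemma index_pointsP l (P : int *l int) : index_points l P ->
  exists n k : nat, [/\ (0 < n)%N, (k <= n)%N, coprime n k,
    P = (n%:Z, k%:Z) & l (n%:R, k%:R)].
Proof.
case: P => x y [/= /andP[y0 yx] cxy lP].
case: x y y0 yx cxy lP => [n|n] [k|k] // _ kn c lP; exists n, k; split=> //.
move: c kn; rewrite /coprimez /= => c; case: (n) c => //.
by rewrite lez_nat leqn0 => c0 /eqP k0; move: c0; rewrite k0.
Qed.

Lemma tree_number_label n k : tree_number m (n%:Z, k%:Z) = label m n k.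
Proof. by rewrite /tree_number /label /frac !pmulrn. Qed.

(* Strictly increasing for the lexicographic order on 0 <= k <= n. *)
Definition lex_code (P : int *l int) : nat := (`|P.1| * `|P.1|.+1 + `|P.2|)%N.

Lemma lex_nat (n k n' k' : nat) :
  (((n%:Z, k%:Z) : int *l int) < ((n'%:Z, k'%:Z) : int *l int))%O =
  (n < n')%N || (n == n') && (k < k')%N.
Proof.
rewrite ltEprodlexi /= !lez_nat !ltz_nat.
case: (ltngtP n n') => //=.
Qed.

Lemma lex_codeE l i j : index_points l i -> index_points l j ->
  (i < j)%O = (lex_code i < lex_code j)%N.
Proof.
move=> /index_pointsP[n [k [n0 kn _ -> _]]] /index_pointsP[n' [k' [n'0 kn' _ -> _]]].
rewrite lex_nat /lex_code /=; apply/idP/idP; first by move=> /orP[|/andP[/eqP ->]]; nia.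
case: (ltngtP n n') => //=; nia.
Qed.

Lemma frac_inj n k n' k' : (0 < n)%N -> coprime n k -> (0 < n')%N -> coprime n' k' ->
  k%:R / n%:R = k'%:R / n'%:R :> R -> n = n' /\ k = k'.
Proof.
move=> n0 c n0' c'; rewrite -!ratr_frac => /fmorph_inj e.
have := congr1 denq e; rewrite !denq_frac// => -[->].
by have := congr1 numq e; rewrite !numq_frac// => -[->].
Qed.

End IndexPoints.

(** * Slopes and parallelism *)

Section Slopes.
Variable R : realType.
Implicit Types (P Q : R * R) (s : \bar R) (l : set (R * R)).

(** Cross-multiplied, equality of slopes is one polynomial identity that also covers vertical
    chords; slopes are carried between lines through it and its converse. *)
Lemma chord_slope_parallel P Q P' Q' s : chord_slope P Q s -> chord_slope P' Q' s ->
  (P.1 - Q.1) * (P'.2 - Q'.2) = (P.2 - Q.2) * (P'.1 - Q'.1).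
Proof.
case=> [[e s1]|[ne ->]] [[e' s2]|[ne' s2]].
- by rewrite e e' !subrr mul0r mulr0.
- by case: s1 s2 => ->.
- by case: s2.
case: s2 => e; have d0 : Q.1 - P.1 != 0 by rewrite subr_eq0 eq_sym; exact/eqP.
have d0' : Q'.1 - P'.1 != 0 by rewrite subr_eq0 eq_sym; exact/eqP.
move/(congr1 (fun x => x * ((Q.1 - P.1) * (Q'.1 - P'.1)))): e.
have -> : (Q.2 - P.2) / (Q.1 - P.1) * ((Q.1 - P.1) * (Q'.1 - P'.1)) =
          (Q.2 - P.2) * (Q'.1 - P'.1) by field.
have -> : (Q'.2 - P'.2) / (Q'.1 - P'.1) * ((Q.1 - P.1) * (Q'.1 - P'.1)) =
          (Q'.2 - P'.2) * (Q.1 - P.1) by field.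
by lra.
Qed.

Lemma parallel_chord_slope P Q P' Q' s : P <> Q -> P' <> Q' -> chord_slope P Q s ->
  (P.1 - Q.1) * (P'.2 - Q'.2) = (P.2 - Q.2) * (P'.1 - Q'.1) -> chord_slope P' Q' s.
Proof.
move=> PQ PQ' [[e s1]|[ne ->]] par.
  left; split=> //; move: par; rewrite e subrr mul0r => /esym/eqP.
  rewrite mulf_eq0 !subr_eq0 => /orP[/eqP e2|/eqP//].
  by case: PQ; move: e e2; case: (P) (Q) => [? ?] [? ?] /= -> ->.
right; have d0 : P.1 - Q.1 != 0 by rewrite subr_eq0; exact/eqP.
have ne' : P'.1 <> Q'.1.
  move=> e; move: par; rewrite e subrr mulr0 => /eqP; rewrite mulf_eq0 (negbTE d0)/= subr_eq0.
  by move=> /eqP e2; case: PQ'; move: e e2; case: (P') (Q') => [? ?] [? ?] /= -> ->.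
split=> //; congr (_%:E).
have d1 : Q.1 - P.1 != 0 by rewrite -opprB oppr_eq0.
have d2 : Q'.1 - P'.1 != 0 by rewrite subr_eq0 eq_sym; exact/eqP.
apply: (mulIf d1); apply: (mulIf d2).
have -> : (Q.2 - P.2) / (Q.1 - P.1) * (Q.1 - P.1) * (Q'.1 - P'.1) =
          (Q.2 - P.2) * (Q'.1 - P'.1) by field.
have -> : (Q'.2 - P'.2) / (Q'.1 - P'.1) * (Q.1 - P.1) * (Q'.1 - P'.1) =
          (Q'.2 - P'.2) * (Q.1 - P.1) by field.
by move: par; lra.
Qed.

Lemma line_parallel l P Q P' Q' : is_line l -> l P -> l Q -> l P' -> l Q' ->
  (P.1 - Q.1) * (P'.2 - Q'.2) = (P.2 - Q.2) * (P'.1 - Q'.1).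
Proof.
move=> [a [b [c [ab ->]]]] /= e1 e2 e3 e4.
have h1 : a * (P.1 - Q.1) = - (b * (P.2 - Q.2)) by lra.
have h2 : a * (P'.1 - Q'.1) = - (b * (P'.2 - Q'.2)) by lra.
case/orP: ab => ab; apply: (mulfI ab).
  by rewrite mulrA h1 [RHS]mulrCA h2; ring.
have -> : b * ((P.1 - Q.1) * (P'.2 - Q'.2)) = (P.1 - Q.1) * (b * (P'.2 - Q'.2)) by ring.
have -> : b * (P'.2 - Q'.2) = - (a * (P'.1 - Q'.1)) by lra.
have -> : b * ((P.2 - Q.2) * (P'.1 - Q'.1)) = (b * (P.2 - Q.2)) * (P'.1 - Q'.1) by ring.
have -> : b * (P.2 - Q.2) = - (a * (P.1 - Q.1)) by lra.
ring.
Qed.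

Lemma chord_slope_line l P Q s : is_line l -> line_slope l s -> l P -> l Q -> P <> Q ->
  chord_slope P Q s.
Proof.
move=> il [P0 [Q0 [lP0 lQ0 ne0 s0]]] lP lQ ne.
by apply: parallel_chord_slope s0 _ => //; exact: line_parallel il _ _ _ _.
Qed.

Lemma chord_direction P Q s : P <> Q -> chord_slope P Q s -> infinite_or_rational s ->
  exists (d1 d2 : int) (T : R), [/\ coprimez d1 d2, 0 < T,
    Q.1 = P.1 + T * d1%:~R & Q.2 = P.2 + T * d2%:~R].
Proof.
move=> ne PQs rat_s.
suff [d1 [d2 [T [c T0 e1 e2]]]] : exists (d1 d2 : int) (T : R), [/\ coprimez d1 d2, T != 0,
    Q.1 = P.1 + T * d1%:~R & Q.2 = P.2 + T * d2%:~R].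
  have [lt_|lt_] := ltP 0 T; first by exists d1, d2, T.
  exists (- d1), (- d2), (- T); rewrite /coprimez gcdzN gcdNz !rmorphN /= !mulrNN; split=> //.
  by rewrite oppr_gt0 lt_neqAle T0.
case: PQs => [[e _]|[ne1 sE]].
  exists 0, 1, (Q.2 - P.2); split=> //.
  - rewrite subr_eq0; apply/eqP => e2; apply: ne.
    by rewrite [P]surjective_pairing [Q]surjective_pairing e e2.
  - by rewrite mulr0 addr0.
  - by rewrite mulr1; ring.
move: rat_s; rewrite sE => -[[]//|[q [qE]]].
have d0 : (denq q)%:~R != 0 :> R by rewrite intr_eq0 denq_eq0.
have dP : Q.1 - P.1 != 0 by rewrite subr_eq0 eq_sym; exact/eqP.
exists (denq q), (numq q), ((Q.1 - P.1) / (denq q)%:~R); split.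
- by rewrite /coprimez /gcdz gcdnC; have := coprime_num_den q; rewrite /coprime => /eqP ->.
- by rewrite mulf_neq0// invr_eq0.
- by field.
- have -> : (numq q)%:~R = ratr q * (denq q)%:~R :> R by rewrite /ratr mulfVK.
  by rewrite -qE; field; rewrite ?dP ?d0.
Qed.

End Slopes.

(** * The homogeneous extension to the cone *)

Section Cone.
Variables (R : realType) (Phi : R -> R).
Hypothesis cPhi : continuous Phi.
Hypothesis Phi_gt0 : forall x : R, 0 <= x <= 1 -> 0 < Phi x.
Implicit Types (P Q : R * R).

Definition ext P : R := P.1 * Phi (P.2 / P.1).
Definition cone P : Prop := 0 < P.1 /\ 0 <= P.2 <= P.1.

Lemma cone_ratio P : cone P -> 0 <= P.2 / P.1 <= 1.
Proof.
move=> [P1 /andP[P2 P21]]; rewrite divr_ge0 ?(ltW P1)//=.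
by rewrite ler_pdivrMr// mul1r.
Qed.

Lemma ext_gt0 P : cone P -> 0 < ext P.
Proof. by move=> cP; rewrite mulr_gt0 ?Phi_gt0 ?cone_ratio//; case: cP. Qed.

Lemma ext_scale c P : 0 < c -> ext (c * P.1, c * P.2) = c * ext P.
Proof.
by move=> c0; rewrite /ext /= -mulf_div divff ?gt_eqF// mul1r mulrA.
Qed.

Lemma lattice_curve_ext P : cone P -> lattice_curve Phi (P.1 / ext P, P.2 / ext P).
Proof.
move=> cP; exists (P.2 / P.1); first exact: cone_ratio.
have P0 : P.1 != 0 by case: cP => /lt0r_neq0.
have F0 : Phi (P.2 / P.1) != 0 by rewrite gt_eqF// Phi_gt0// cone_ratio.
by rewrite /ext; congr pair; field; rewrite F0.
Qed.

Lemma lattice_curve_cone P : lattice_curve Phi P -> cone P /\ ext P = 1.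
Proof.
move=> [x x01 ->]; have F0 := Phi_gt0 x01.
split; last first.
  rewrite /ext /=; have -> : x / Phi x / (1 / Phi x) = x by field; rewrite gt_eqF.
  by rewrite mul1r mulVf// gt_eqF.
split; first by rewrite /= divr_gt0.
by case/andP: x01 => x0 x1; rewrite /= divr_ge0 ?(ltW F0)//= ler_pM2r ?invr_gt0.
Qed.

Lemma ext_path_continuous (x0 x1 y0 y1 t : R) : 0 < x0 + t * x1 ->
  {for t, continuous (fun u : R => ext (x0 + u * x1, y0 + u * y1))}.
Proof.
move=> xt.
have lin (a b : R) : {for t, continuous (fun u : R => a + u * b)}.
  by apply: cvgD; [exact: cvg_cst|apply: cvgM; [exact: cvg_id|exact: cvg_cst]].
apply: cvgM; first exact: lin.
apply: (@cvg_comp _ _ _ (fun t => (y0 + t * y1) / (x0 + t * x1)) Phi); last exact: cPhi.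
by apply: cvgM; [exact: lin|apply: cvgV; [exact: lt0r_neq0|exact: lin]].
Qed.

Lemma cone_convex t P Q : 0 <= t <= 1 -> cone P -> cone Q ->
  cone (P.1 + t * (Q.1 - P.1), P.2 + t * (Q.2 - P.2)).
Proof.
move=> /andP[t0 t1] [P1 /andP[P2 P3]] [Q1 /andP[Q2 Q3]]; split=> /=.
  by nra.
by apply/andP; split; nra.
Qed.

(* If [ext] orders two pairs of points of a line differently, then some pair in
   between has equal values, and rescaling it yields a chord of the lattice curve. *)
Lemma slope_of_unordered (l : set (R * R)) (s : \bar R) P Q P' Q' :
  is_line l -> line_slope l s -> l P -> l Q -> l P' -> l Q' ->
  cone P -> cone Q -> cone P' -> cone Q' ->
  P.1 < Q.1 \/ P.1 = Q.1 /\ P.2 < Q.2 ->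
  P'.1 < Q'.1 \/ P'.1 = Q'.1 /\ P'.2 < Q'.2 ->
  ext Q <= ext P -> ext P' <= ext Q' -> slope_interval Phi s.
Proof.
move=> il ls lP lQ lP' lQ' cP cQ cP' cQ' PQ PQ' eQP ePQ'.
(* [A] runs from [P] to [P'] and [B] from [Q] to [Q']; the pairs at both ends are ordered alike, so
   [A] and [B] never meet. *)
pose A (t : R) := (P.1 + t * (P'.1 - P.1), P.2 + t * (P'.2 - P.2)).
pose B (t : R) := (Q.1 + t * (Q'.1 - Q.1), Q.2 + t * (Q'.2 - Q.2)).
have cA t : 0 <= t <= 1 -> cone (A t) by move=> t01; exact: cone_convex.
have cB t : 0 <= t <= 1 -> cone (B t) by move=> t01; exact: cone_convex.
have lAB t : l (A t) /\ l (B t).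
  case: il lP lQ lP' lQ' => a [b [c [_ ->]]] /= e1 e2 e3 e4; split.
    transitivity (a * P.1 + b * P.2 + t * ((a * P'.1 + b * P'.2) - (a * P.1 + b * P.2))).
      by rewrite /A /=; ring.
    by rewrite e1 e3; ring.
  transitivity (a * Q.1 + b * Q.2 + t * ((a * Q'.1 + b * Q'.2) - (a * Q.1 + b * Q.2))).
    by rewrite /B /=; ring.
  by rewrite e2 e4; ring.
have AB t : 0 <= t <= 1 -> A t <> B t.
  move=> /andP[t0 t1] [e1 e2].
  have mix (a b : R) : 0 < a -> 0 < b -> 0 < (1 - t) * a + t * b.
    by move=> a0 b0; have [->|tn] := eqVneq t 0; [lra|have : 0 < t by rewrite lt_neqAle eq_sym tn]; nra.
  case: PQ PQ' => [h|[h1 h2]] [h'|[h1' h2']].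
  - by have := mix (Q.1 - P.1) (Q'.1 - P'.1); rewrite !subr_gt0 => /(_ h h'); lra.
  - have t1' : t = 1 by nra.
    by move: e2; rewrite t1'; lra.
  - have t0' : t = 0 by nra.
    by move: e2; rewrite t0'; lra.
  - by have := mix (Q.2 - P.2) (Q'.2 - P'.2); rewrite !subr_gt0 => /(_ h2 h2'); lra.
pose g t := ext (A t) - ext (B t).
have cg : {within `[0, 1], continuous g}.
  apply: continuous_in_subspaceT => t; rewrite inE/= in_itv/= => t01.
  by apply: cvgB; apply: ext_path_continuous; [case: (cA t t01)|case: (cB t t01)].
have g0 : 0 <= g 0.
  by rewrite /g /A /B !mul0r !addr0 -!surjective_pairing subr_ge0.
have g1 : g 1 <= 0.
  by rewrite /g /A /B !mul1r ![_ + (_ - _)]addrC !subrK -!surjective_pairing subr_le0.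
have [|t] := @IVT R g 0 1 0 ler01 cg.
  by rewrite ge_min le_max g0 g1 orbT.
rewrite in_itv/= => t01 /eqP; rewrite subr_eq0 => /eqP eAB.
have e0 := ext_gt0 (cA t t01).
(* Division by the common value of [ext] puts both points on the lattice curve and keeps the
   direction. *)
exists ((A t).1 / ext (A t), (A t).2 / ext (A t)), ((B t).1 / ext (B t), (B t).2 / ext (B t)).
have ne : ((A t).1 / ext (A t), (A t).2 / ext (A t)) <> ((B t).1 / ext (B t), (B t).2 / ext (B t)).
  rewrite -eAB => -[/(mulIf (invr_neq0 (lt0r_neq0 e0))) e1 /(mulIf (invr_neq0 (lt0r_neq0 e0))) e2].
  by apply: (AB t t01); rewrite /A /B e1 e2.
split=> //; [exact/lattice_curve_ext/cA|exact/lattice_curve_ext/cB|].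
have [lA lB] := lAB t.
apply: parallel_chord_slope (AB t t01) ne (chord_slope_line il ls lA lB (AB t t01)) _.
by rewrite -eAB /=; field; exact: lt0r_neq0.
Qed.

Lemma near_itv (p : R -> Prop) (t : R) : (\forall x \near t, p x) ->
  exists2 e : R, 0 < e & forall x, t - e < x < t + e -> p x.
Proof.
move=> /nbhs_ballP[e /= e0 H]; exists e => // x xe.
by apply: H; rewrite /ball/= ltr_distlC.
Qed.

End Cone.

Section LatticePoints.
Variable R : realType.

(* Points [p e + t d] with [p] a large prime not dividing [t] are primitive when
   [d, e] is a basis of Z^2, and their multiples by [c / p] are dense on a line. *)
Lemma prime_avoiding (c a b : R) : 0 < c -> a < b -> exists K : nat,
  forall p, prime p -> (K <= p)%N ->
    exists t : int, ~~ (p %| `|t|)%N /\ a < t%:~R * c / p%:R < b.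
Proof.
move=> c0 ab; pose K := Num.bound (2 * c / (b - a)).
have KP : 2 * c / (b - a) < K%:R by rewrite archi_boundP// divr_ge0//; lra.
exists K => p pp Kp; have p0 : (0 : R) < p%:R by rewrite ltr0n prime_gt0.
have : 2 * c / (b - a) < p%:R by apply: (lt_le_trans KP); rewrite ler_nat.
rewrite ltr_pdivrMr ?subr_gt0// => pl.
(* The interval allowed for [t] is longer than 2, so it contains two consecutive integers, of which
   [p] divides at most one. *)
pose t := Num.floor (a * p%:R / c).
have tl : t%:~R <= a * p%:R / c by exact: floor_le_tmp.
have tr : a * p%:R / c < (t + 1)%:~R by exact: floorD1_gt.
have [t' [t't pt']] : exists t' : int, (t' = t + 1 \/ t' = t + 2) /\ ~~ (p %| `|t'|)%N.
  have [d1|d1] := boolP (p %| `|(t + 1)%R|)%N; last by exists (t + 1); split=> //; left.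
  exists (t + 2); split; [by right|apply/negP => d2].
  have : (p%:Z %| (t + 2) - (t + 1))%Z by rewrite rpredB.
  have -> : (t + 2) - (t + 1) = 1 :> int by lia.
  rewrite dvdz1 absz_nat => /eqP p1; by rewrite p1 in pp.
exists t'; split=> //.
have t1 : (t + 1)%:~R <= t'%:~R :> R by rewrite ler_int; lia.
have t2 : t'%:~R <= t%:~R + 2 :> R by rewrite -[2]/(2%:~R) -intrD ler_int; lia.
rewrite ltr_pdivrMr// ltr_pdivlMr//.
move: tl tr; rewrite ler_pdivlMr// ltr_pdivrMr// => tl tr.
apply/andP; split; nra.
Qed.

End LatticePoints.

(** * Labels along lines *)

(** The weight of each outer point is the distance from [B] to the other one, measured in the first
    coordinate, or in the second on a vertical line. *)
Lemma lex_between (R : realType) (A B C : R * R) :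
  A.1 < B.1 \/ A.1 = B.1 /\ A.2 < B.2 -> B.1 < C.1 \/ B.1 = C.1 /\ B.2 < C.2 ->
  (B.1 - A.1) * (C.2 - B.2) = (B.2 - A.2) * (C.1 - B.1) ->
  exists u v, [/\ 0 < u, 0 < v, u * A.1 + v * C.1 = (u + v) * B.1 &
    u * A.2 + v * C.2 = (u + v) * B.2].
Proof.
case: A B C => [a1 a2] [b1 b2] [c1 c2] /= [ab|[ab ab']] [bc|[bc bc']] par.
- by exists (c1 - b1), (b1 - a1); split; lra.
- have : (b1 - a1) * (c2 - b2) = 0 by rewrite par bc subrr mulr0.
  by move=> /eqP; rewrite mulf_eq0 !subr_eq0 => /orP[/eqP e|/eqP e]; lra.
- have : (b2 - a2) * (c1 - b1) = 0 by rewrite -par ab subrr mul0r.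
  by move=> /eqP; rewrite mulf_eq0 !subr_eq0 => /orP[/eqP e|/eqP e]; lra.
- by exists (c2 - b2), (b2 - a2); rewrite -bc ab; split; lra.
Qed.

Lemma lex_lt_line (a1 a2 d1 d2 t t' : int) : t < t' -> (0 < d1) || (d1 == 0) && (0 < d2) ->
  (((a1 + t * d1, a2 + t * d2) : int *l int) < ((a1 + t' * d1, a2 + t' * d2) : int *l int))%O.
Proof.
move=> tt' dpos; rewrite ltEprodlexi /=.
by case/orP: dpos => [|/andP[/eqP ->]] dp; apply/andP; split; nia.
Qed.

Lemma lex_gt_line (a1 a2 d1 d2 t t' : int) : t < t' -> (d1 != 0) || (d2 != 0) ->
  ~~ ((0 < d1) || (d1 == 0) && (0 < d2)) ->
  (((a1 + t' * d1, a2 + t' * d2) : int *l int) < ((a1 + t * d1, a2 + t * d2) : int *l int))%O.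
Proof.
move=> tt' d0 dneg; have dpos : (0 < - d1) || (- d1 == 0) && (0 < - d2) by lia.
(* Seen from the point of parameter [t + t'], the direction [- d] exchanges the parameters [t] and
   [t']. *)
have := lex_lt_line (a1 + (t + t') * d1) (a2 + (t + t') * d2) tt' dpos.
have e (a d : int) : a + (t + t') * d + t * - d = a + t' * d by ring.
have e' (a d : int) : a + (t + t') * d + t' * - d = a + t * d by ring.
by rewrite !e !e'.
Qed.

Section TreeNumbers.
Variables (R : realType) (s0 u0 t0 : R) (m : rat -> R) (Phi : R -> R).
Hypothesis hT : markov_tree s0 u0 t0 m.
Hypothesis hrising : rising m.
Hypothesis cPhi : continuous Phi.
Hypothesis Phi_ge0 : forall x : R, 0 <= x <= 1 -> 0 <= Phi x.
Hypothesis labelE : forall n k, (0 < n)%N -> (k <= n)%N -> coprime n k ->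
  label m n k = 2 * Defs.cosh (n%:R * Phi (k%:R / n%:R)).

Local Notation D := (discriminator s0 u0 t0).
Local Notation cosh := (@Defs.cosh R).
Local Notation ext := (ext Phi).
Implicit Types (l : set (R * R)) (P Q : R * R).

Let Phi_pos (x : R) : 0 <= x <= 1 -> 0 < Phi x.
Proof. exact: (Phi_gt0 hrising cPhi Phi_ge0 labelE). Qed.

Definition real_point (P : int *l int) : R * R := (P.1%:~R, P.2%:~R).

Lemma index_cone l i : index_points l i ->
  [/\ cone (real_point i), l (real_point i) &
      tree_number m i = 2 * cosh (ext (real_point i))].
Proof.
move=> /index_pointsP[n [k [n0 kn c -> ln]]]; split=> //.
  by rewrite /cone /= ltr0n n0 ler0n ler_nat kn.
by rewrite tree_number_label labelE.
Qed.

(** Primitive points on one ray coincide. Since [ext] is linear along rays, strict convexity needs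
    the ratios to differ. *)
Lemma index_ratio l i j : index_points l i -> index_points l j -> (i < j)%O ->
  (real_point i).2 / (real_point i).1 <> (real_point j).2 / (real_point j).1.
Proof.
move=> /index_pointsP[n [k [n0 kn c -> ln]]] /index_pointsP[n' [k' [n0' kn' c' -> ln']]].
by move=> + /frac_inj => /[swap] -[]// -> ->; rewrite ltxx.
Qed.

Lemma index_lt l i j : index_points l i -> index_points l j -> (i < j)%O ->
  (real_point i).1 < (real_point j).1 \/
  (real_point i).1 = (real_point j).1 /\ (real_point i).2 < (real_point j).2.
Proof.
move=> /index_pointsP[n [k [n0 kn c -> ln]]] /index_pointsP[n' [k' [n0' kn' c' -> ln']]].
rewrite lex_nat /= => /orP[nn|/andP[/eqP -> kk]]; first by left; rewrite ltr_nat.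
by right; split=> //; rewrite ltr_nat.
Qed.

Lemma index_monotone l s : index_line l -> line_slope l s -> ~ slope_interval Phi s ->
  monotone_on (index_points l) (tree_number m).
Proof.
move=> [il _] ls ns.
have [inc|ninc] := pselect (increasing_on (index_points l) (tree_number m)); first by left.
right => i' j' Si' Sj' ij'; rewrite ltNge; apply/negP => fij'.
apply: ninc => i j Si Sj ij; rewrite ltNge; apply/negP => fji.
apply: ns.
have [ci li fi] := index_cone Si; have [cj lj fj] := index_cone Sj.
have [ci' li' fi'] := index_cone Si'; have [cj' lj' fj'] := index_cone Sj'.
move: fji fij'; rewrite fi fj fi' fj' !ler_pM2l// !cosh_le_mono ?(ltW (ext_gt0 Phi_pos _))//.
exact: slope_of_unordered il ls li lj li' lj' ci cj ci' cj' (index_lt Si Sj ij) (index_lt Si' Sj' ij').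
Qed.

Section Sign.
Variable s : R.
Hypothesis s_sign : s = 1 \/ s = -1.
Hypothesis sD : 0 < s * (4 - D).

(** [ext] is the perspective of [Phi]: with weights [u * P.1] and [v * W.1] the ratio of [Q] is the
    mean of those of [P] and [W], and strict convexity of [s * Phi] applies there. *)
Lemma ext_strictly_convex P Q W u v : cone P -> cone W -> P.2 / P.1 <> W.2 / W.1 ->
  0 < u -> 0 < v ->
  u * P.1 + v * W.1 = (u + v) * Q.1 -> u * P.2 + v * W.2 = (u + v) * Q.2 ->
  (u + v) * (s * ext Q) < u * (s * ext P) + v * (s * ext W).
Proof.
move=> + + + up vp.
have convex := strictly_convex hT hrising cPhi Phi_ge0 labelE s_sign sD.
wlog lt_ : P W u v up vp / P.2 / P.1 < W.2 / W.1.
  move=> H cP cW ne e1 e2; have [lt_|lt_|//] := ltgtP (P.2 / P.1) (W.2 / W.1).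
    exact: H.
  rewrite addrC [ltRHS]addrC; apply: H => //; first by exact: nesym.
    by rewrite addrC e1 addrC.
  by rewrite addrC e2 addrC.
move=> cP cW _ e1 e2.
have uv0 : 0 < u + v by rewrite addr_gt0.
have P0 : 0 < P.1 by case: cP.
have W0 : 0 < W.1 by case: cW.
have Q0 : 0 < Q.1 by rewrite -(pmulr_rgt0 _ uv0) -e1 addr_gt0// mulr_gt0.
set x := P.2 / P.1 in lt_; set y := W.2 / W.1 in lt_; set z := Q.2 / Q.1.
have Px : P.2 = x * P.1 by rewrite /x mulfVK// gt_eqF.
have Wy : W.2 = y * W.1 by rewrite /y mulfVK// gt_eqF.
have Qz : Q.2 = z * Q.1 by rewrite /z mulfVK// gt_eqF.
have A0 : 0 < u * P.1 by rewrite mulr_gt0.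
have B0 : 0 < v * W.1 by rewrite mulr_gt0.
rewrite /ext -/x -/y -/z.
have mix : u * P.1 * x + v * W.1 * y = (u * P.1 + v * W.1) * z.
  by rewrite e1 -[RHS]mulrA [Q.1 * z]mulrC -Qz -e2 Px Wy; ring.
have -> : (u + v) * (s * (Q.1 * Phi z)) = (u * P.1 + v * W.1) * (s * Phi z).
  by rewrite e1; ring.
have -> : u * (s * (P.1 * Phi x)) + v * (s * (W.1 * Phi y)) =
    u * P.1 * (s * Phi x) + v * W.1 * (s * Phi y) by ring.
move: A0 B0 mix; set A := u * P.1; set B := v * W.1 => A0 B0 mix.
have AB0 : 0 < A + B by rewrite addr_gt0.
have zx : (A + B) * (z - x) = B * (y - x) by lra.
have yz : (A + B) * (y - z) = A * (y - x) by lra.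
have yx0 : 0 < y - x by rewrite subr_gt0.
have xz : x < z by rewrite -subr_gt0 -(pmulr_rgt0 _ AB0) zx mulr_gt0.
have zy : z < y by rewrite -subr_gt0 -(pmulr_rgt0 _ AB0) yz mulr_gt0.
have /andP[x0 _] := cone_ratio cP; have /andP[_ y1] := cone_ratio cW.
have := convex x y z x0 y1; rewrite xz zy => /(_ isT).
rewrite -(ltr_pM2l AB0) => H; rewrite -(ltr_pM2l yx0).
have -> : (y - x) * ((A + B) * (s * Phi z)) = (A + B) * ((y - x) * (s * Phi z)) by ring.
apply: (lt_le_trans H); rewrite le_eqVlt; apply/orP; left; apply/eqP.
transitivity ((A + B) * (y - z) * (s * Phi x) + (A + B) * (z - x) * (s * Phi y)); first by ring.
by rewrite zx yz; ring.
Qed.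

(** [cosh] of a concave function need not be concave, so only order is passed on: the middle value
    of [s * ext] lies strictly below one of the outer ones, and [cosh] preserves the comparison. *)
Lemma index_quasiconvex l i j k : is_line l ->
  index_points l i -> index_points l j -> index_points l k -> (i < j)%O -> (j < k)%O ->
  Num.min (- (s * tree_number m i)) (- (s * tree_number m k)) < - (s * tree_number m j).
Proof.
move=> il Si Sj Sk ij jk.
have [ci li fi] := index_cone Si; have [cj lj fj] := index_cone Sj.
have [ck lk fk] := index_cone Sk.
have ltij := index_lt Si Sj ij; have ltjk := index_lt Sj Sk jk.
have ne := index_ratio Si Sk (lt_trans ij jk).
have par := line_parallel il lj li lk lj.
have sle a b : cone a -> cone b -> s * (2 * cosh (ext a)) <= s * (2 * cosh (ext b)) ->
    s * ext a <= s * ext b.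
  move=> ca cb; have a0 := ltW (ext_gt0 Phi_pos ca); have b0 := ltW (ext_gt0 Phi_pos cb).
  by case: s_sign => ->; rewrite ?mul1r ?mulN1r ?lerN2 ler_pM2l// cosh_le_mono.
rewrite ltNge; apply/negP; rewrite le_min !lerN2 fi fj fk => /andP[/(sle _ _ ci cj) h1 /(sle _ _ ck cj) h2].
have [u [v [up vp e1 e2]]] := lex_between ltij ltjk par.
have := ext_strictly_convex ci ck ne up vp e1 e2.
by nra.
Qed.

End Sign.

Lemma index_antimodal l : is_line l -> D < 4 -> antimodal_on (index_points l) (tree_number m).
Proof.
move=> il D4; apply: (modal_of_quasiconcave (c := lex_code)); first exact: lex_codeE.
move=> i j k Si Sj Sk ij jk; have sD : 0 < 1 * (4 - D) by lra.
by have := index_quasiconvex (or_introl erefl) sD il Si Sj Sk ij jk; rewrite !mul1r.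
Qed.

Lemma index_modal l : is_line l -> 4 < D -> modal_on (index_points l) (tree_number m).
Proof.
move=> il D4; apply: (modal_of_quasiconcave (c := lex_code)); first exact: lex_codeE.
move=> i j k Si Sj Sk ij jk; have sD : 0 < -1 * (4 - D) by lra.
by have := index_quasiconvex (or_intror erefl) sD il Si Sj Sk ij jk; rewrite !mulN1r !opprK.
Qed.

Lemma ext_affine : D = 4 -> exists al be : R, forall P, cone P -> ext P = al * P.1 + be * P.2.
Proof.
move=> D4; have [al [be PhiE]] := Phi_affine hT hrising cPhi Phi_ge0 labelE D4.
exists al, be => P cP; rewrite /ext PhiE ?cone_ratio//; field.
by case: cP => /lt0r_neq0.
Qed.

(** [ext] is 1 at both ends of the chord, so the linear form that it is for D = 4 vanishes on the
    direction of the chord, which is that of the line. *)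
Lemma index_constant l s : is_line l -> line_slope l s -> slope_interval Phi s -> D = 4 ->
  constant_on (index_points l) (tree_number m).
Proof.
move=> il ls [P [Q [lP lQ ne PQs]]] D4 i j Si Sj.
have [al [be extE]] := ext_affine D4.
have [cP P1] := lattice_curve_cone Phi_pos lP; have [cQ Q1] := lattice_curve_cone Phi_pos lQ.
have [ci li ->] := index_cone Si; have [cj lj ->] := index_cone Sj.
congr (2 * cosh _); rewrite !extE//.
move: P1 Q1; rewrite !extE// => P1 Q1.
have [P0 [Q0 [lP0 lQ0 ne0 s0']]] := ls.
have e1 := chord_slope_parallel PQs s0'.
have e2 := line_parallel il li lj lP0 lQ0.
have dPQ : al * (P.1 - Q.1) + be * (P.2 - Q.2) = 0 by lra.
have e3 : (P.1 - Q.1) * ((real_point i).2 - (real_point j).2) =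
          (P.2 - Q.2) * ((real_point i).1 - (real_point j).1).
  have [pij|nij] := pselect (real_point i = real_point j); first by rewrite pij !subrr !mulr0.
  exact: chord_slope_parallel PQs (chord_slope_line il ls li lj nij).
set x := (real_point i).1 - _ in e3; set y := (real_point i).2 - _ in e3.
suff : al * x + be * y = 0 by rewrite /x /y; lra.
have [z1|z1] := eqVneq (P.1 - Q.1) 0.
  have z2 : P.2 - Q.2 != 0.
    apply/eqP => z2; apply: ne; rewrite [P]surjective_pairing [Q]surjective_pairing.
    by congr pair; apply/eqP; rewrite -subr_eq0 ?z1 ?z2.
  apply: (mulfI z2); transitivity (al * ((P.2 - Q.2) * x) + be * (P.2 - Q.2) * y); first by ring.
  rewrite -e3; have -> : be * (P.2 - Q.2) = - (al * (P.1 - Q.1)) by lra.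
  by rewrite z1; ring.
apply: (mulfI z1); transitivity (al * (P.1 - Q.1) * x + be * ((P.1 - Q.1) * y)); first by ring.
rewrite e3; have -> : al * (P.1 - Q.1) = - (be * (P.2 - Q.2)) by lra.
ring.
Qed.

(* Up to sign, [ext] dips in the middle of a segment with equal end values. *)
Lemma ext_valley P (d1 d2 T : R) : 0 < T -> cone P -> cone (P.1 + T * d1, P.2 + T * d2) ->
  P.2 / P.1 <> (P.2 + T * d2) / (P.1 + T * d1) ->
  ext P = ext (P.1 + T * d1, P.2 + T * d2) ->
  exists s a1 b1 a2 b2 a3 b3 : R, [/\ s = 1 \/ s = -1,
    [/\ 0 <= a1, a1 < b1, b1 <= a2 & a2 < b2], [/\ b2 <= a3, a3 < b3 & b3 <= T] &
    forall x1 x2 x3, a1 < x1 < b1 -> a2 < x2 < b2 -> a3 < x3 < b3 ->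
      s * ext (P.1 + x2 * d1, P.2 + x2 * d2) <= s * ext (P.1 + x1 * d1, P.2 + x1 * d2) /\
      s * ext (P.1 + x2 * d1, P.2 + x2 * d2) <= s * ext (P.1 + x3 * d1, P.2 + x3 * d2)].
Proof.
move=> T0 cP cQ ne ePQ.
pose W (x : R) := (P.1 + x * d1, P.2 + x * d2).
have cW x : 0 <= x <= T -> cone (W x).
  move=> /andP[x0 xT].
  have xT01 : 0 <= x / T <= 1 by rewrite divr_ge0 ?(ltW T0)//= ler_pdivrMr// mul1r.
  have := cone_convex xT01 cP cQ; rewrite /W /=.
  have -> : P.1 + x / T * (P.1 + T * d1 - P.1) = P.1 + x * d1 by field; exact: lt0r_neq0.
  by have -> : P.2 + x / T * (P.2 + T * d2 - P.2) = P.2 + x * d2 by field; exact: lt0r_neq0.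
have W0 : W 0 = P by rewrite /W !mul0r !addr0 -surjective_pairing.
have [D4|D4] := eqVneq D 4.
  have [al [be extE]] := ext_affine D4.
  have cst : al * d1 + be * d2 = 0.
    apply: (mulfI (lt0r_neq0 T0)); move: ePQ; rewrite !extE//=; lra.
  (* Weak inequalities suffice, since monotone means strictly monotone; a constant [ext] satisfies
     them on any three intervals. *)
  exists 1, 0, (T / 3), (T / 3), (2 * T / 3), (2 * T / 3), T.
  split; [by left|split; lra|split; lra|].
  move=> x1 x2 x3 /andP[? ?] /andP[? ?] /andP[? ?].
  have ext_cst x : 0 <= x <= T -> ext (W x) = ext P.
    move=> xT; rewrite !extE//=; last exact: cW.
    transitivity (al * P.1 + be * P.2 + x * (al * d1 + be * d2)); first by ring.
    by rewrite cst; ring.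
  by rewrite -!/(W _) !ext_cst//; apply/andP; split; lra.
have [s [s_sign sD]] : exists s : R, (s = 1 \/ s = -1) /\ 0 < s * (4 - D).
  have [lt_|lt_] := ltP D 4; first by exists 1; split; [left|lra].
  exists (-1); split; [by right|].
  have : 4 < D by rewrite lt_neqAle eq_sym D4.
  lra.
have mid : s * ext (W (T / 2)) < s * ext P.
  have := ext_strictly_convex s_sign sD (Q := W (T / 2)) cP cQ ne ltr01 ltr01.
  rewrite -ePQ !mul1r /W /= => H.
  have : (1 + 1) * (s * ext (P.1 + T / 2 * d1, P.2 + T / 2 * d2)) < s * ext P + s * ext P.
    by apply: H; field.
  lra.
(* This level separates the middle value from the end values, and by continuity does so on whole
   neighbourhoods. *)
pose h := (s * ext (W (T / 2)) + s * ext P) / 2.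
have cWs x : 0 <= x <= T -> {for x, continuous (fun u => s * ext (W u))}.
  move=> xT; apply: cvgM; first exact: cvg_cst.
  by apply: ext_path_continuous => //; case: (cW x xT).
have [e1 e10 H1] : exists2 e : R, 0 < e & forall x, 0 - e < x < 0 + e -> h < s * ext (W x).
  apply: near_itv; apply: (cvgr_gt _ (cWs 0 _)); first by rewrite lexx ltW.
  by rewrite W0 /h; lra.
have [e2 e20 H2] : exists2 e : R, 0 < e & forall x, T / 2 - e < x < T / 2 + e -> s * ext (W x) < h.
  apply: near_itv; apply: (cvgr_lt _ (cWs (T / 2) _)); first by apply/andP; split; lra.
  by rewrite /h; lra.
have [e3 e30 H3] : exists2 e : R, 0 < e & forall x, T - e < x < T + e -> h < s * ext (W x).
  apply: near_itv; apply: (cvgr_gt _ (cWs T _)); first by rewrite lexx ltW.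
  by rewrite /W -ePQ /h; lra.
exists s, 0, (Num.min e1 (T / 3)), (Num.max (T / 2 - e2) (T / 3)),
  (Num.min (T / 2 + e2) (2 * T / 3)), (Num.max (T - e3) (2 * T / 3)), T.
split=> //.
- split=> //.
  + by rewrite lt_min e10; lra.
  + by rewrite le_max !ge_min lexx !orbT.
  + by rewrite lt_min !gt_max; apply/andP; split; apply/andP; split; lra.
- split=> //.
  + by rewrite le_max !ge_min lexx !orbT.
  + by rewrite gt_max; apply/andP; split; lra.
move=> x1 x2 x3; rewrite !lt_min !gt_max.
move=> /andP[x10 /andP[x11 x12]] /andP[/andP[x20 x21] /andP[x22 x23]] /andP[/andP[x30 x31] x32].
have := H1 x1; have := H2 x2; have := H3 x3; rewrite /W => h3 h2 h1.
have {}h1 := h1 ltac:(apply/andP; split; lra).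
have {}h2 := h2 ltac:(apply/andP; split; lra).
have {}h3 := h3 ltac:(apply/andP; split; lra).
by split; apply: ltW; [exact: lt_trans h2 h1|exact: lt_trans h2 h3].
Qed.

(** In a basis [g], [d] of Z^2, the lattice points [p g + t d] scaled by [c / p] fall on the line of
    a chord with equal [ext] at both ends. For a large prime [p], primitive ones land in all three
    intervals of the valley, which excludes strict monotonicity. *)
Lemma exists_nonmonotone (s : \bar R) : slope_interval Phi s -> infinite_or_rational s ->
  exists l, [/\ index_line l, line_slope l s & ~ monotone_on (index_points l) (tree_number m)].
Proof.
move=> [P [Q [lP lQ ne PQs]]] rat_s.
have [cP P1] := lattice_curve_cone Phi_pos lP; have [cQ Q1] := lattice_curve_cone Phi_pos lQ.
have [d1 [d2 [T [cd T0 e1 e2]]]] := chord_direction ne PQs rat_s.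
have QE : Q = (P.1 + T * d1%:~R, P.2 + T * d2%:~R) by rewrite [LHS]surjective_pairing e1 e2.
have P0 : 0 < P.1 by case: cP.
have Q0 : 0 < Q.1 by case: cQ.
have ratio : P.2 / P.1 <> Q.2 / Q.1.
  move=> r; apply: ne.
  have P1Q1 : P.1 = Q.1.
    have F0 : Phi (P.2 / P.1) != 0 by rewrite gt_eqF// Phi_pos// cone_ratio.
    by apply: (mulIf F0); rewrite [RHS]/= {2}r -/(ext P) -/(ext Q) P1 Q1.
  rewrite [P]surjective_pairing [Q]surjective_pairing -P1Q1; congr pair.
  by rewrite -[P.2](mulfVK (lt0r_neq0 P0)) r P1Q1 mulfVK// gt_eqF.
pose det := d1%:~R * P.2 - d2%:~R * P.1 : R.
have det0 : det != 0.
  apply/eqP => det0; apply: ratio.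
  apply: (mulIf (lt0r_neq0 P0)); apply: (mulIf (lt0r_neq0 Q0)).
  rewrite mulfVK ?gt_eqF// -mulrA [P.1 * Q.1]mulrC mulrA mulfVK ?gt_eqF// e1 e2.
  by move: det0; rewrite /det; nra.
have [f1 [f2 fd]] : exists f1 f2 : int, d1 * f2 - d2 * f1 = 1.
  by have /coprimezP[[a b] /= ab] := cd; exists (- b), a; rewrite -ab; ring.
(* The sign makes [c] positive, so the scaling by [p / c] stays inside the cone. *)
have [eps [epsE c0]] : exists eps : int, (eps = 1 \/ eps = -1) /\ 0 < eps%:~R * det.
  have [lt_|lt_] := ltP 0 det; first by exists 1; split; [left|rewrite mul1r].
  exists (-1); split; [by right|].
  by rewrite mulN1r oppr_gt0 lt_neqAle det0.
have [g1 [g2 gd]] : exists g1 g2 : int, d1 * g2 - d2 * g1 = eps.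
  by exists (eps * f1), (eps * f2); rewrite -[RHS]mulr1 -fd; ring.
have eps2 : eps%:~R * eps%:~R = 1 :> R by case: epsE => ->; ring.
have gdR : d1%:~R * g2%:~R - d2%:~R * g1%:~R = eps%:~R :> R.
  by rewrite -!intrM -intrB gd.
set c := eps%:~R * det in c0.
(* [c] and [tP] are the coordinates of [P] in the basis [g], [d]. *)
pose tP := eps%:~R * (P.1 * g2%:~R - P.2 * g1%:~R) : R.
have P1E : P.1 = c * g1%:~R + tP * d1%:~R.
  transitivity (eps%:~R * (d1%:~R * g2%:~R - d2%:~R * g1%:~R) * P.1).
    by rewrite gdR eps2 mul1r.
  by rewrite /c /tP /det; ring.
have P2E : P.2 = c * g2%:~R + tP * d2%:~R.
  transitivity (eps%:~R * (d1%:~R * g2%:~R - d2%:~R * g1%:~R) * P.2).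
    by rewrite gdR eps2 mul1r.
  by rewrite /c /tP /det; ring.
rewrite QE in cQ ratio Q1.
have [s' [a1 [b1 [a2 [b2 [a3 [b3 [s'E [a10 ab1 ba2 ab2] [ba3 ab3 b3T] valley]]]]]]]] :=
  ext_valley T0 cP cQ ratio (etrans P1 (esym Q1)).
have [K1 pick1] := prime_avoiding c0 (ltr_leD ab1 (lexx tP)).
have [K2 pick2] := prime_avoiding c0 (ltr_leD ab2 (lexx tP)).
have [K3 pick3] := prime_avoiding c0 (ltr_leD ab3 (lexx tP)).
have [p pK pp] := prime_above (K1 + K2 + K3).
have [|t1 [pt1 t1ab]] := pick1 p pp; first by rewrite (leq_trans _ (ltnW pK))// -addnA leq_addr.
have [|t2 [pt2 t2ab]] := pick2 p pp; first by rewrite (leq_trans _ (ltnW pK))// addnAC leq_addl.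
have [|t3 [pt3 t3ab]] := pick3 p pp; first by rewrite (leq_trans _ (ltnW pK))// leq_addl.
have p0 : 0 < p%:R :> R by rewrite ltr0n prime_gt0.
pose tau (t : int) := t%:~R * c / p%:R - tP.
pose W (t : int) : int *l int := (p%:Z * g1 + t * d1, p%:Z * g2 + t * d2).
pose V (x : R) := (P.1 + x * d1%:~R, P.2 + x * d2%:~R).
have cV x : 0 <= x <= T -> cone (V x).
  move=> /andP[x0 xT].
  have xT01 : 0 <= x / T <= 1 by rewrite divr_ge0 ?(ltW T0)//= ler_pdivrMr// mul1r.
  have := cone_convex xT01 cP cQ; rewrite /V /=.
  have -> : P.1 + x / T * (P.1 + T * d1%:~R - P.1) = P.1 + x * d1%:~R by field; exact: lt0r_neq0.
  by have -> : P.2 + x / T * (P.2 + T * d2%:~R - P.2) = P.2 + x * d2%:~R by field; exact: lt0r_neq0.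
have pc0 : 0 < p%:R / c by rewrite divr_gt0.
have WV t : real_point (W t) = (p%:R / c * (V (tau t)).1, p%:R / c * (V (tau t)).2).
  rewrite /real_point /W /V /= !intrD !intrM P1E P2E /tau -!pmulrn.
  by congr pair; field; rewrite !lt0r_neq0.
pose l := [set X : R * R | (- d2%:~R) * X.1 + d1%:~R * X.2 = (p%:Z * eps)%:~R].
have lW t : l (real_point (W t)).
  rewrite /l /= -rmorphN -!intrM -intrD; congr (_%:~R); rewrite -gd; ring.
(* The basis is unimodular, so a common divisor of the coordinates divides both [p] and [t]. *)
have copW t : ~~ (p %| `|t|)%N -> coprimez (W t).1 (W t).2.
  move=> pt; rewrite /coprimez; set g := gcdz _ _.
  have gl : (g %| (W t).1)%Z by exact: dvdz_gcdl.
  have gr : (g %| (W t).2)%Z by exact: dvdz_gcdr.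
  have gp : (g %| p%:Z)%Z.
    have -> : p%:Z = eps * (d1 * (W t).2 - d2 * (W t).1).
      have -> : d1 * (W t).2 - d2 * (W t).1 = p%:Z * eps by rewrite /W /= -gd; ring.
      by case: epsE => ->; ring.
    by rewrite dvdz_mull// rpredB// dvdz_mull.
  have gt : (g %| t)%Z.
    have -> : t = eps * (g2 * (W t).1 - g1 * (W t).2).
      have -> : g2 * (W t).1 - g1 * (W t).2 = t * eps by rewrite /W /= -gd; ring.
      by case: epsE => ->; ring.
    by rewrite dvdz_mull// rpredB// dvdz_mull.
  move: gp gt; rewrite /dvdz /= => gp gt.
  have /primeP[_ /(_ _ gp) /orP[/eqP g1'|/eqP gp']] := pp.
    by move: g1'; rewrite /g /gcdz /= => ->.
  by move: gt; rewrite gp' => pgt; case/negP: pt; exact: pgt.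
have idx t : ~~ (p %| `|t|)%N -> 0 <= tau t <= T -> index_points l (W t).
  move=> pt /cV[]; rewrite /= => V1 /andP[V2 V3]; split; [|exact: copW|exact: lW].
  have [w1 w2] : (W t).1%:~R = p%:R / c * (V (tau t)).1 :> R /\
                 (W t).2%:~R = p%:R / c * (V (tau t)).2 :> R by case: (WV t).
  rewrite -(ler0z R) -(ler_int R) w1 w2 mulr_ge0 ?(ltW pc0)//=.
  by rewrite ler_pM2l.
have tau1 : a1 < tau t1 < b1 by rewrite /tau; case/andP: t1ab; lra.
have tau2 : a2 < tau t2 < b2 by rewrite /tau; case/andP: t2ab; lra.
have tau3 : a3 < tau t3 < b3 by rewrite /tau; case/andP: t3ab; lra.
have S1 : index_points l (W t1) by apply: idx => //; case/andP: tau1; lra.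
have S2 : index_points l (W t2) by apply: idx => //; case/andP: tau2; lra.
have S3 : index_points l (W t3) by apply: idx => //; case/andP: tau3; lra.
have cp0 : 0 < c / p%:R by rewrite divr_gt0.
have tau_lt t t' : tau t < tau t' -> t < t'.
  by rewrite /tau ltrD2r ltr_pM2r ?invr_gt0// ltr_pM2r// ltr_int.
have t12 : t1 < t2 by apply: tau_lt; case/andP: tau1; case/andP: tau2; lra.
have t23 : t2 < t3 by apply: tau_lt; case/andP: tau2; case/andP: tau3; lra.
have d_neq0 : (d1 != 0) || (d2 != 0).
  by have [d1z|//] := eqVneq d1 0; apply/eqP => d2z; move: fd; rewrite d1z d2z !mul0r subrr.
have il : is_line l.
  exists (- d2%:~R), d1%:~R, (p%:Z * eps)%:~R; split=> //.
  by rewrite oppr_eq0 !intr_eq0 orbC.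
exists l; split.
- by split=> //; exists (W t1).
- exists (real_point (W t1)), (real_point (W t2)).
  have neW : real_point (W t1) <> real_point (W t2).
    rewrite /real_point => -[/intr_inj w1 /intr_inj w2].
    have w1' : (t1 - t2) * d1 = 0 by rewrite mulrBl (addrI _ w1) subrr.
    have w2' : (t1 - t2) * d2 = 0 by rewrite mulrBl (addrI _ w2) subrr.
    have : (t1 - t2) * 1 = 0 by rewrite -fd mulrBr !mulrA w1' w2'; ring.
    by rewrite mulr1 => /eqP; rewrite subr_eq0 => /eqP t12'; rewrite t12' ltxx in t12.
  split=> //; apply: parallel_chord_slope ne neW PQs _.
  by rewrite QE /= !intrD !intrM; ring.
have ext_W t : ext (real_point (W t)) = p%:R / c * ext (V (tau t)).
  by rewrite WV ext_scale.
have [v1 v2] := valley _ _ _ tau1 tau2 tau3.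
have tree_le t t' : index_points l (W t) -> index_points l (W t') ->
    s' * ext (V (tau t)) <= s' * ext (V (tau t')) ->
    s' * tree_number m (W t) <= s' * tree_number m (W t').
  move=> St St' H; have [ct _ ->] := index_cone St; have [ct' _ ->] := index_cone St'.
  have x0 := ltW (ext_gt0 Phi_pos ct); have y0 := ltW (ext_gt0 Phi_pos ct').
  have key : s' * ext (real_point (W t)) <= s' * ext (real_point (W t')).
    by rewrite !ext_W [leLHS]mulrCA [leRHS]mulrCA ler_pM2l.
  by case: s'E key => ->; rewrite ?mul1r ?mulN1r ?lerN2 => key; rewrite ler_pM2l// cosh_le_mono.
have w1 := tree_le _ _ S2 S1 v1; have w3 := tree_le _ _ S2 S3 v2.
(* [d] points from [P] to [Q], possibly against the lexicographic order; the three points are then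
   met in reverse. *)
have [dpos|dneg] := boolP ((0 < d1) || (d1 == 0) && (0 < d2)).
  case=> mono; have := mono _ _ S1 S2 (lex_lt_line _ _ t12 dpos);
    have := mono _ _ S2 S3 (lex_lt_line _ _ t23 dpos); by case: s'E w1 w3 => ->; lra.
case=> mono; have := mono _ _ S2 S1 (lex_gt_line _ _ t12 d_neq0 dneg);
  have := mono _ _ S3 S2 (lex_gt_line _ _ t23 d_neq0 dneg); by case: s'E w1 w3 => ->; lra.
Qed.

End TreeNumbers.

(** * The theorem *)

(** Clamping the argument to [[0, 1]] gives continuity on the whole line; labels and lattice curve
    only see the values on [[0, 1]]. *)
Lemma continuous_extension (R : realType) (f : R -> R) : {within `[0, 1], continuous f} ->
  exists2 g : R -> R, continuous g & forall x, 0 <= x <= 1 -> g x = f x.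
Proof.
move=> cf; pose clamp (t : R) := Num.max 0 (Num.min t 1).
have clamp01 t : 0 <= clamp t <= 1.
  by rewrite le_max lexx/= ge_max ler01 ge_min lexx orbT.
exists (f \o clamp); last first.
  by move=> x /andP[x0 x1]; rewrite /= /clamp (min_idPl x1) (max_idPr x0).
move=> t; have cl : clamp @ t --> clamp t.
  apply: (@continuous_max R R (fun=> 0) (fun t => Num.min t 1)); first exact: cvg_cst.
  by apply: (@continuous_min R R id (fun=> 1)); [exact: cvg_id|exact: cvg_cst].
have in01 u : `[0, 1]%classic (clamp u) by rewrite /= in_itv/= clamp01.
apply: (@cvg_comp _ _ _ clamp f _ (within `[0, 1]%classic (nbhs (clamp t)))).
  move=> U HU; rewrite /= nbhs_filterE /fmap/=.
  have : nbhs t [set u | `[0, 1]%classic (clamp u) -> U (clamp u)] := cl _ HU.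
  by apply: filterS => u; apply; exact: in01.
by rewrite (nbhs_subspace_in (in01 t)); exact: cf.
Qed.

Theorem theorem7p2 (R : realType) (s0 u0 t0 : R) (m : rat -> R) (Phi : R -> R)
    (hT : markov_tree s0 u0 t0 m) (hrising : rising m)
    (hPhi : encoding_function m Phi) :
  (forall (l : set (R * R)) (s : \bar R), index_line l -> line_slope l s ->
     (~ slope_interval Phi s ->
        monotone_on (index_points l) (tree_number m)) /\
     (slope_interval Phi s ->
        [/\ discriminator s0 u0 t0 < 4 ->
              antimodal_on (index_points l) (tree_number m),
            discriminator s0 u0 t0 = 4 ->
              constant_on (index_points l) (tree_number m) &
            4 < discriminator s0 u0 t0 ->
              modal_on (index_points l) (tree_number m)])) /\
  (forall s : \bar R, slope_interval Phi s -> infinite_or_rational s ->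
     exists l : set (R * R),
       [/\ index_line l, line_slope l s &
           ~ monotone_on (index_points l) (tree_number m)]).
Proof.
have [cPhi Phi_ge0 PhiE] := hPhi.
have [g cg gE] := continuous_extension cPhi.
have g_ge0 (x : R) : 0 <= x <= 1 -> 0 <= g x by move=> x01; rewrite gE ?Phi_ge0.
have labelE n k : (0 < n)%N -> (k <= n)%N -> coprime n k ->
    label m n k = 2 * Defs.cosh (n%:R * g (k%:R / n%:R)).
  move=> n0 kn c; rewrite gE ?fracR_itv// /label PhiE ?frac_itv//.
  by rewrite denq_frac// ratr_frac -pmulrn.
have slopeE : slope_interval Phi = slope_interval g.
  have curveE : lattice_curve Phi = lattice_curve g.
    by apply/seteqP; split=> P [x x01 ->]; exists x => //; rewrite gE.
  by rewrite /slope_interval curveE.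
rewrite slopeE; split; last exact: exists_nonmonotone hT hrising cg g_ge0 labelE.
move=> l s il ls; split; first exact: index_monotone hrising cg g_ge0 labelE _ _ il ls.
move=> Is; split=> hD.
- exact: index_antimodal hT hrising cg g_ge0 labelE _ il.1 hD.
- exact: index_constant hT hrising cg g_ge0 labelE _ _ il.1 ls Is hD.
- exact: index_modal hT hrising cg g_ge0 labelE _ il.1 hD.
Qed.
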